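(* Let $(M^{2n-1},\xi)$ be a contact manifold. The following two conditions are equivalent: (i) $M$ admits a co-Legendrian foliation $\mathcal F$ which has an invariant transverse smooth measure, i.e. such that for each leaf $F$ of $\mathcal F$ the codimension one foliation $\mathcal G|_F$ of $F$ (where $\mathcal G$ is the Legendrian foliation associated with $\mathcal F$) has a holonomy invariant transverse smooth measure; (ii) $M$ admits a co-Legendrian foliation $\mathcal F$ together with a contact 1-form $\lambda$ (with $\ker\lambda=\xi$) whose Reeb vector field is tangent to $\mathcal F$.
   Context: All objects are smooth. A contact manifold $(M^{2n-1},\xi)$ is a manifold of dimension $2n-1$ with a completely non-integrable hyperplane distribution $\xi$. A foliation $\mathcal F$ of dimension $n$ on $M$ is called co-Legendrian if it is transverse to $\xi$ (no tangent space of a leaf is contained in $\xi$) and the distribution $T\mathcal F\cap\xi$ is integrable; the resulting $(n-1)$-dimensional foliation $\mathcal G$, tangent to $\xi$, is the Legendrian foliation associated with $\mathcal F$. The leaves of $\mathcal G$ foliate each leaf $F$ of $\mathcal F$ with codimension one. A holonomy invariant transverse smooth measure of $\mathcal G$ on a leaf $F$ is a nowhere vanishing 1-form $\alpha_F$ on $F$ with $\ker\alpha_F=T\mathcal G$ which is basic for $\mathcal G$: $i_u\alpha_F=0$ and $L_u\alpha_F=0$ for every vector field $u$ on $F$ tangent to $\mathcal G$; equivalently, it descends to a non-vanishing 1-form on the (locally defined) 1-dimensional space of leaves of $\mathcal G$ in $F$. When such measures are given on all leaves of $\mathcal F$, the forms $\alpha_F$ are understood to depend smoothly on the leaf, i.e.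 to form a smooth section of $T^*\mathcal F$ over $M$. The Reeb vector field $v$ of a contact form $\lambda$ is defined by $i_v d\lambda=0$ and $\lambda(v)=1$. *)

(* Defs.v *)
From HB Require Import structures.
From mathcomp Require Import all_boot all_order all_algebra.
From mathcomp Require Import all_classical all_reals all_analysis.

Set Implicit Arguments.
Unset Strict Implicit.
Unset Printing Implicit Defensive.

Import Order.TTheory GRing.Theory Num.Theory.
Import numFieldNormedType.Exports.

Local Open Scope classical_set_scope.
Local Open Scope ring_scope.

Section SmoothFunctions.
Variable R : realType.

Definition partial k (i : 'I_k) (f : 'rV[R]_k -> R) (x : 'rV[R]_k) : R :=
  'D_(delta_mx 0 i) f x.

(* C^oo on an open set U: all iterated partial derivatives are
   (Frechet) differentiable at the points of U. *)
Definition smooth_on k (U : set 'rV[R]_k) (f : 'rV[R]_k -> R) : Prop :=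
  forall (s : seq 'I_k) (x : 'rV[R]_k), U x ->
    differentiable (foldr (@partial k) f s) x.

Definition smooth_map k l (U : set 'rV[R]_k) (f : 'rV[R]_k -> 'rV[R]_l) : Prop :=
  forall j : 'I_l, smooth_on U (fun x => f x 0 j).

End SmoothFunctions.

(* The values of cfun outside cdom, and of cinv outside the image of cdom, are
   irrelevant. *)
Record chart (R : realType) (d : nat) (M : topologicalType) := Chart {
  cdom : set M;
  cfun : M -> 'rV[R]_d;
  cinv : 'rV[R]_d -> M;
  cdom_open : open cdom;
  cimg_open : open (cfun @` cdom);
  cfunK : {in cdom, cancel cfun cinv};
  cfun_continuous : {within cdom, continuous cfun};
  cinv_continuous : {within cfun @` cdom, continuous cinv} }.

Definition smooth_transition R d M (c c' : chart R d M) : Prop :=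
  smooth_map (cfun c @` (cdom c `&` cdom c')) (cfun c' \o cinv c).

Definition compatible R d M (c c' : chart R d M) : Prop :=
  smooth_transition c c' /\ smooth_transition c' c.

(* The smooth structure is a maximal atlas.  A preferred chart around each point
   is part of the data; it serves to identify the tangent space with R^d. *)
Record smooth_manifold (R : realType) (d : nat) := SmoothManifold {
  carrier :> topologicalType;
  carrier_hausdorff : hausdorff_space carrier;
  carrier_second_countable : @second_countable carrier;
  atlas : set (chart R d carrier);
  atlas_compatible :
    forall c c', atlas c -> atlas c' -> compatible c c';
  atlas_maximal :
    forall c, (forall c', atlas c' -> compatible c c') -> atlas c;
  chart_at : carrier -> chart R d carrier;
  chart_at_atlas : forall p, atlas (chart_at p);
  chart_at_dom : forall p, cdom (chart_at p) p }.

Section Tensors.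
Variables (R : realType) (d : nat) (M : smooth_manifold R d).
Implicit Types (c : chart R d M) (p : M).

(* The tangent space at p is 'rV[R]_d, a vector being given by its components in
   the chart chart_at p.  tcoord c p v are the components of v in the chart c,
   and tvec c p is the inverse map. *)
Definition tcoord c p (v : 'rV[R]_d) : 'rV[R]_d :=
  'd (cfun c \o cinv (chart_at p)) (cfun (chart_at p) p) v.

Definition tvec c p (w : 'rV[R]_d) : 'rV[R]_d :=
  'd (cfun (chart_at p) \o cinv c) (cfun c p) w.

Definition vfield := M -> 'rV[R]_d.

Definition vcoef c (X : vfield) (i : 'I_d) (x : 'rV[R]_d) : R :=
  tcoord c (cinv c x) (X (cinv c x)) 0 i.

Definition smooth_vfield (X : vfield) : Prop :=
  forall c, atlas c -> forall i, smooth_on (cfun c @` cdom c) (vcoef c X i).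

Definition linear_on (D : set 'rV[R]_d) (f : 'rV[R]_d -> R) : Prop :=
  forall (a : R) v w, D v -> D w -> f (a *: v + w) = a * f v + f w.

(* Used both for 1-forms on M and for sections of the dual of a distribution D;
   in the latter case only the values of the form on D are meaningful. *)
Definition one_form := M -> 'rV[R]_d -> R.

Definition fcoef c (a : one_form) (i : 'I_d) (x : 'rV[R]_d) : R :=
  a (cinv c x) (tvec c (cinv c x) (delta_mx 0 i)).

Definition smooth_1form (U : set M) (a : one_form) : Prop :=
  (forall p, U p -> linear_on setT (a p)) /\
  (forall c, atlas c -> forall i,
     smooth_on (cfun c @` (cdom c `&` U)) (fcoef c a i)).

(* The exterior derivative at p, computed in the chart chart_at p, in which the
   components of v and w are v and w themselves. *)
Definition ext_deriv (a : one_form) p (v w : 'rV[R]_d) : R :=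
  let c := chart_at p in
  \sum_(i < d) \sum_(j < d)
    (partial i (fcoef c a j) (cfun c p) - partial j (fcoef c a i) (cfun c p))
    * v 0 i * w 0 j.

Definition plane_field := M -> set 'rV[R]_d.

Definition form_ker (a : one_form) : plane_field := fun p => [set v | a p v = 0].

(* d a is nondegenerate on ker a, i.e. a /\ (d a)^(n-1) is a volume form when
   d = 2n-1. *)
Definition contact_form (U : set M) (a : one_form) : Prop :=
  smooth_1form U a /\
  forall p, U p ->
    (exists v, a p v <> 0) /\
    (forall v, form_ker a p v ->
       (forall w, form_ker a p w -> ext_deriv a p v w = 0) -> v = 0).

Definition contact_structure (xi : plane_field) : Prop :=
  forall p : M, exists (U : set M) (theta : one_form),
    [/\ open U, U p, contact_form U theta
      & forall q, U q -> xi q = form_ker theta q].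

Definition is_reeb (lambda : one_form) (v : vfield) : Prop :=
  smooth_vfield v /\
  forall p, (forall w, ext_deriv lambda p (v p) w = 0) /\ lambda p (v p) = 1.

End Tensors.

(* In a chart adapted to an n-dimensional foliation, the first n coordinates are
   the coordinates along the leaves. *)
Definition same_slice (R : realType) d (n : nat) (x y : 'rV[R]_d) : Prop :=
  forall j : 'I_d, (n <= j)%N -> x 0 j = y 0 j.

(* A foliated atlas: the charts have open boxes as images, so that the slices of
   a chart (its plaques) are connected, and each transition map is locally of the
   form (s, t) |-> (f (s, t), g t). *)
Record foliation R d (M : smooth_manifold R d) (n : nat) := Foliation {
  fatlas : set (chart R d M);
  fatlas_sub : fatlas `<=` @atlas R d M;
  fatlas_cover : forall p, exists2 c, fatlas c & cdom c p;
  fatlas_box : forall c, fatlas c -> exists a b : 'rV[R]_d,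
    cfun c @` cdom c = [set x | forall i, a 0 i < x 0 i < b 0 i];
  fatlas_slice : forall c c', fatlas c -> fatlas c' ->
    forall x, (cfun c @` (cdom c `&` cdom c')) x ->
    exists2 W, nbhs x W &
      forall y z, W y -> W z -> same_slice n y z ->
        same_slice n (cfun c' (cinv c y)) (cfun c' (cinv c z)) }.

Section Foliations.
Variables (R : realType) (d : nat) (M : smooth_manifold R d) (n : nat).
Variable F : foliation M n.

Definition tangent : plane_field M := fun p =>
  [set v | forall c, fatlas F c -> cdom c p -> same_slice n (tcoord c p v) 0].

Inductive same_leaf (p : M) : M -> Prop :=
| same_leaf_refl : same_leaf p p
| same_leaf_plaque c q r : same_leaf p q -> fatlas F c -> cdom c q -> cdom c r ->
    same_slice n (cfun c q) (cfun c r) -> same_leaf p r.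

Definition is_leaf (L : set M) : Prop := exists p, L = [set q | same_leaf p q].

(* The point with leaf coordinates z and the transverse coordinates of x. *)
Definition slice_pt (x : 'rV[R]_d) (z : 'rV[R]_n) : 'rV[R]_d :=
  \row_j if insub (val j) is Some i then z 0 i else x 0 j.

(* Vector fields on the immersed submanifold L: only the values of u on L matter,
   and smoothness is smoothness in the coordinates of the plaques contained in L. *)
Definition leaf_vfield (L : set M) (u : vfield M) : Prop :=
  (forall p, L p -> tangent p (u p)) /\
  (forall c, fatlas F c -> forall p, cdom c p -> L p -> forall i : 'I_d,
     smooth_on [set z | (cfun c @` cdom c) (slice_pt (cfun c p) z)]
       (fun z => vcoef c u i (slice_pt (cfun c p) z))).

(* The i-th component, in the leaf coordinates of c, of the Lie derivative of a
   along u: (L_u a)_i = u^j d_j a_i + a_j d_i u^j.  Both i and j range over the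
   leaf directions, so that only derivatives along the leaf occur. *)
Definition leaf_lie_deriv (u : vfield M) (a : one_form M) (c : chart R d M)
    (p : M) (i : 'I_d) : R :=
  \sum_(j < d | (j < n)%N)
    (vcoef c u j (cfun c p) * partial j (fcoef c a i) (cfun c p) +
     fcoef c a j (cfun c p) * partial i (vcoef c u j) (cfun c p)).

(* Smooth sections over M of the dual of the tangent bundle of F. *)
Definition smooth_leafwise_form (a : one_form M) : Prop :=
  (forall p, linear_on (tangent p) (a p)) /\
  (forall c, fatlas F c -> forall i : 'I_d, (i < n)%N ->
     smooth_on (cfun c @` cdom c) (fcoef c a i)).

(* The restriction of a to L is a nowhere vanishing 1-form with kernel D, basic
   for the foliation of L tangent to D. *)
Definition invariant_transverse_measure (D : plane_field M) (a : one_form M)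
    (L : set M) : Prop :=
  (forall p, L p -> exists2 v, tangent p v & a p v <> 0) /\
  (forall p, L p -> tangent p `&` form_ker a p = D p) /\
  (forall u, leaf_vfield L u -> (forall p, L p -> D p (u p)) ->
     forall p, L p -> a p (u p) = 0 /\
       forall c, fatlas F c -> cdom c p ->
         forall i : 'I_d, (i < n)%N -> leaf_lie_deriv u a c p i = 0).

Variable xi : plane_field M.

Definition legendrian_distribution : plane_field M :=
  fun p => tangent p `&` xi p.

Definition transverse : Prop := forall p, ~ (tangent p `<=` xi p).

End Foliations.

Definition integrable_field R d (M : smooth_manifold R d) (k : nat)
    (D : plane_field M) : Prop :=
  exists G : foliation M k, forall p, tangent G p = D p.

Definition co_legendrian R d (M : smooth_manifold R d) n (F : foliation M n)
    (xi : plane_field M) : Prop :=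
  transverse F xi /\ integrable_field n.-1 (legendrian_distribution F xi).

Definition has_invariant_measure R d (M : smooth_manifold R d) n
    (F : foliation M n) (xi : plane_field M) : Prop :=
  exists2 a : one_form M, smooth_leafwise_form F a &
    forall L, is_leaf F L ->
      invariant_transverse_measure F (legendrian_distribution F xi) a L.

(* Main.v *)
Require Import Defs.
From mathcomp Require Import all_boot all_order all_algebra.
From mathcomp Require Import all_classical all_reals all_analysis.
From mathcomp Require Import ring lra.

Set Implicit Arguments.
Unset Strict Implicit.
Unset Printing Implicit Defensive.

Import Order.TTheory GRing.Theory Num.Theory.
Import numFieldNormedType.Exports.

(** Both directions keep the foliation F and exchange the leafwise form a for
a contact form lambda which restricts to a on TF.

Suppose that the Reeb field v of lambda is tangent to F.  In a chart adapted to
G the coefficients of lambda along the plaques vanish identically, hence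
d lambda vanishes on TG (isotropic_of_integral).  As TF is spanned by TG and v,
and v lies in the kernel of d lambda, d lambda (u, w) = 0 for u in TG and w in
TF.  For a field u tangent to G, Cartan's formula on a leaf
(leaf_lie_derivE) reads L_u lambda = i_u d lambda + d (lambda u), and both terms
vanish along the leaf: the restriction of lambda is an invariant measure.

Suppose conversely that a is an invariant measure.  Since a has kernel
TF /\ xi on TF, there is exactly one 1-form lambda with kernel xi which
restricts to a (extension_exists); locally it is a quotient of coefficients of
a and of a contact form theta, multiplied by theta, so it is smooth
(smooth_of_extension) and it is a contact form (contact_of_kernel).  Every
vector of TG extends, up to a positive factor, to a global field tangent to G
(bump_vfield), so the invariance of a together with Cartan's formula gives
d lambda (u, w) = 0 for u in TG and w in TF.  As TG is a hyperplane of TF and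
d lambda is antisymmetric, TF is isotropic.  In dimension 2n-1 an isotropic
subspace T of dimension n contains the kernel of d lambda: otherwise
w |-> d lambda (w, .) would be injective on T with values in the annihilator of
T, whose dimension is n-1 (isotropic_reeb).  That kernel is the Reeb direction.

The exterior derivative and the tangent spaces are defined with preferred
charts, while the arguments above use charts adapted to F or to G.  What links
them is that d lambda transforms by congruence under a change of chart
(dmat_change), which rests on the symmetry of second partials (partialC). *)

(** * Smooth functions on open subsets of R^k *)

Section Calculus.
Local Open Scope classical_set_scope.
Local Open Scope ring_scope.
Context {R : realType}.

Lemma near_eq_diff (V W : normedModType R) (f g : V -> W) x :
  {near x, f =1 g} -> differentiable f x ->
  differentiable g x /\ 'd g x = 'd f x :> (V -> W).
Proof.
move=> fg /diff_locallyP [dfc dfE].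
have gE : g \o shift x = cst (g x) + 'd f x +o_ 0 id.
  apply/eqaddoP => e e0; move/eqaddoP : dfE => /(_ e e0) dfE.
  have := fg; rewrite /prop_near1 [X in X -> _](near_shift 0) subr0 => fg0.
  move: dfE fg0; apply: filterS2 => y /=.
  rewrite -![(_ + _ : _ -> _) _]/(_ + _) -![(- _ : _ -> _) _]/(- _) /=.
  by rewrite /cst (nbhs_singleton fg) => + <-.
have dgE := diff_unique dfc gE.
split; last exact: dgE.
by apply/diff_locallyP; split; rewrite dgE; [exact: dfc|exact: gE].
Qed.

Lemma differentiable_rV (V : normedModType R) k (f : V -> 'rV[R]_k) x :
  (forall j, differentiable (fun y => f y 0 j) x) -> differentiable f x.
Proof.
move=> df.
have -> : f = \sum_(j < k) (fun y => f y 0 j *: (delta_mx 0 j : 'rV[R]_k)).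
  rewrite funeqE => y; rewrite fct_sumE {1}[f y]row_sum_delta.
  by [].
by apply: differentiable_sum => j; exact: differentiableZl.
Qed.

Lemma diff_rVE (V : normedModType R) k (f : V -> 'rV[R]_k) x v j :
  differentiable f x -> 'd f x v 0 j = 'd (fun y => f y 0 j) x v.
Proof.
move=> df.
have dc := @differentiable_coord R 1 k (f x) 0 j.
rewrite -deriveE // derive_mx; last exact: diff_derivable.
by rewrite mxE deriveE // (_ : (fun _ => _) = (fun N : 'M[R]_(1, k) => N 0 j) \o f) //;
   exact: differentiable_comp.
Qed.

Lemma differentiable_coordf (V : normedModType R) k (f : V -> 'rV[R]_k) x j :
  differentiable f x -> differentiable (fun y => f y 0 j) x.
Proof.
move=> df; rewrite (_ : (fun _ => _) = (fun N : 'M[R]_(1, k) => N 0 j) \o f) //.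
by apply: differentiable_comp => //; exact: differentiable_coord.
Qed.

Lemma partialE k (f : 'rV[R]_k -> R) x i :
  differentiable f x -> partial i f x = 'd f x (delta_mx 0 i).
Proof. by move=> df; rewrite /partial deriveE. Qed.

Lemma diff_partial k (f : 'rV[R]_k -> R) x v :
  differentiable f x -> 'd f x v = \sum_i v 0 i * partial i f x.
Proof.
move=> df; rewrite {1}[v]row_sum_delta linear_sum.
by apply: eq_bigr => i _; rewrite linearZ partialE.
Qed.

Lemma partial_comp k l (f : 'rV[R]_l -> R) (phi : 'rV[R]_k -> 'rV[R]_l) x i :
  differentiable phi x -> differentiable f (phi x) ->
  partial i (f \o phi) x =
  \sum_(m < l) partial m f (phi x) * partial i (fun y => phi y 0 m) x.
Proof.
move=> dphi df; rewrite partialE; last exact: differentiable_comp.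
rewrite diff_comp //= diff_partial //; apply: eq_bigr => m _.
rewrite mulrC (partialE (f := fun y => phi y 0 m)) ?diff_rVE //.
exact: differentiable_coordf.
Qed.

Lemma near_eq_partial k (f g : 'rV[R]_k -> R) x i :
  {near x, f =1 g} -> partial i f x = partial i g x.
Proof. exact: near_eq_derive. Qed.

Lemma partialD k (f g : 'rV[R]_k -> R) x i :
  differentiable f x -> differentiable g x ->
  partial i (fun y => f y + g y) x = partial i f x + partial i g x.
Proof.
by move=> df dg; rewrite /partial (deriveD (f := f) (g := g)) //;
   exact: diff_derivable.
Qed.

Lemma partialM k (f g : 'rV[R]_k -> R) x i :
  differentiable f x -> differentiable g x ->
  partial i (fun y => f y * g y) x = f x * partial i g x + g x * partial i f x.
Proof.
by move=> df dg; rewrite /partial (deriveM (f := f) (g := g)) //;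
   exact: diff_derivable.
Qed.

Lemma partialV k (f : 'rV[R]_k -> R) x i : f x != 0 ->
  differentiable f x ->
  partial i (fun y => (f y)^-1) x = - ((f x)^-1 * (f x)^-1 * partial i f x).
Proof.
move=> f0 df; rewrite /partial (deriveV (f := f)) //; last exact: diff_derivable.
by rewrite /GRing.scale /= mulNr -exprVn expr2.
Qed.

Lemma partial_cst k (a : R) (x : 'rV[R]_k) i : partial i (fun=> a) x = 0.
Proof. exact: derive_cst. Qed.

Lemma partial_sum k m (f : 'I_m -> 'rV[R]_k -> R) x i :
  (forall j, differentiable (f j) x) ->
  partial i (fun y => \sum_(j < m) f j y) x = \sum_(j < m) partial i (f j) x.
Proof.
move=> df; rewrite /partial (_ : (fun y => _) = \sum_(j < m) f j).
  by rewrite derive_sum // => j; exact: diff_derivable.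
by rewrite funeqE => y; rewrite fct_sumE.
Qed.

Lemma partial_coord k (x : 'rV[R]_k) i j :
  partial i (fun y => y 0 j) x = (j == i)%:R.
Proof.
rewrite partialE; last exact: differentiable_coord.
rewrite -(@diff_rVE _ _ id); last exact: (@ex_diff _ _ _ _ _ id).
by rewrite diff_val mxE eqxx.
Qed.

(** Differentiability of all iterated partials of order at most m.  Partials
are taken innermost first, whereas smooth_on adds them outermost: in this form
induction on m settles products, inverses and composites, because the partials
of these are built from functions to which the induction hypothesis applies. *)
Fixpoint Cn k (m : nat) (U : set 'rV[R]_k) (f : 'rV[R]_k -> R) : Prop :=
  (forall x, U x -> differentiable f x) /\
  if m is m'.+1 then forall i, Cn m' U (partial i f) else True.

Lemma smooth_partial k (U : set 'rV[R]_k) f i :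
  smooth_on U f -> smooth_on U (partial i f).
Proof. by move=> sf s x Ux; rewrite -foldr_rcons; exact: sf. Qed.

Lemma smooth_diff k (U : set 'rV[R]_k) f x :
  smooth_on U f -> U x -> differentiable f x.
Proof. by move=> sf Ux; exact: (sf [::]). Qed.

Lemma smooth_onP k (U : set 'rV[R]_k) f :
  smooth_on U f <-> forall m, Cn m U f.
Proof.
split => [sf m|cf s].
  elim: m f sf => [|m IH] f sf /=; split => //.
  - by move=> x; exact: smooth_diff.
  - by move=> x; exact: smooth_diff.
  - by move=> i; apply: IH; exact: smooth_partial.
elim/last_ind: s f cf => [|s i IH] f cf x Ux /=; first by have [+ _] := cf 0%N; exact.
by rewrite foldr_rcons; apply: IH => // m; have [_ +] := cf m.+1; exact.
Qed.

Lemma Cn_diff k m (U : set 'rV[R]_k) f x : Cn m U f -> U x -> differentiable f x.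
Proof. by case: m => [|m] [+ _]; exact. Qed.

Lemma Cn_partial k m (U : set 'rV[R]_k) f i : Cn m.+1 U f -> Cn m U (partial i f).
Proof. by case=> _; apply. Qed.

Lemma CnS k m (U : set 'rV[R]_k) f : Cn m.+1 U f -> Cn m U f.
Proof.
elim: m f => [|m IH] f [df cf]; first by split.
by split => // i; exact/IH/cf.
Qed.

Section OpenSet.
Variables (k : nat) (U : set 'rV[R]_k).
Hypothesis Uo : open U.
Implicit Types f g : 'rV[R]_k -> R.

Lemma open_near x : U x -> \forall y \near x, U y.
Proof. by move=> Ux; exact: open_nbhs_nbhs (conj Uo Ux). Qed.

Lemma eq_on_near f g x : {in U, f =1 g} -> U x -> {near x, f =1 g}.
Proof.
move=> fg Ux; apply: filterS (open_near Ux) => y Uy.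
by apply: fg; rewrite inE.
Qed.

Lemma Cn_eq m f g : {in U, f =1 g} -> Cn m U f -> Cn m U g.
Proof.
elim: m f g => [|m IH] f g fg cf; split => //.
- by move=> x Ux; have [] := near_eq_diff (eq_on_near fg Ux) (Cn_diff cf Ux).
- by move=> x Ux; have [] := near_eq_diff (eq_on_near fg Ux) (Cn_diff cf Ux).
- move=> i; apply: IH (Cn_partial i cf) => x; rewrite inE => Ux.
  exact: near_eq_partial (eq_on_near fg Ux).
Qed.

Lemma Cn_cst m a : Cn m U (fun=> a).
Proof.
elim: m a => [|m IH] a; first by split.
split => // i.
by apply: (@Cn_eq _ (fun=> 0)) => // x _; rewrite partial_cst.
Qed.

Lemma CnD m f g : Cn m U f -> Cn m U g -> Cn m U (fun x => f x + g x).
Proof.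
elim: m f g => [|m IH] f g cf cg.
  by split => // x Ux; apply: differentiableD; [exact: Cn_diff cf Ux|exact: Cn_diff cg Ux].
split; first by [move=> x Ux; apply: differentiableD;
  [exact: Cn_diff cf Ux|exact: Cn_diff cg Ux]].
move=> i; apply: (@Cn_eq _ (fun x => partial i f x + partial i g x)).
  by move=> x; rewrite inE => Ux; rewrite partialD //;
    [exact: Cn_diff cf Ux|exact: Cn_diff cg Ux].
by apply: IH; exact: Cn_partial.
Qed.

Lemma CnM m f g : Cn m U f -> Cn m U g -> Cn m U (fun x => f x * g x).
Proof.
elim: m f g => [|m IH] f g cf cg.
  by split => // x Ux; apply: differentiableM; [exact: Cn_diff cf Ux|exact: Cn_diff cg Ux].
split; first by [move=> x Ux; apply: differentiableM;
  [exact: Cn_diff cf Ux|exact: Cn_diff cg Ux]].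
move=> i; apply: (@Cn_eq _ (fun x => f x * partial i g x + g x * partial i f x)).
  by move=> x; rewrite inE => Ux; rewrite partialM //;
    [exact: Cn_diff cf Ux|exact: Cn_diff cg Ux].
by apply: CnD; apply: IH; (exact: Cn_partial || exact: CnS).
Qed.

Lemma CnV m f : (forall x, U x -> f x != 0) -> Cn m U f ->
  Cn m U (fun x => (f x)^-1).
Proof.
move=> f0; elim: m => [|m IH] cf.
  by split => // x Ux; apply: differentiableV; [exact: Cn_diff cf Ux|exact: f0].
split; first by [move=> x Ux; apply: differentiableV; [exact: Cn_diff cf Ux|exact: f0]].
move=> i; apply: (@Cn_eq _ (fun x => (-1) * (((f x)^-1 * (f x)^-1) * partial i f x))).
  move=> x; rewrite inE => Ux; rewrite partialV ?mulN1r //; first exact: f0.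
  exact: Cn_diff cf Ux.
have cf' := IH (CnS cf).
by apply: CnM; [exact: Cn_cst|apply: CnM; [exact: CnM|exact: Cn_partial]].
Qed.

Lemma Cn_sum m r (f : 'I_r -> 'rV[R]_k -> R) :
  (forall j, Cn m U (f j)) -> Cn m U (fun x => \sum_(j < r) f j x).
Proof.
elim: r f => [|r IH] f cf.
  by apply: (@Cn_eq _ (fun=> 0)) => [x _|]; [rewrite big_ord0|exact: Cn_cst].
apply: (@Cn_eq _ (fun x => \sum_(j < r) f (widen_ord (leqnSn r) j) x + f ord_max x)).
  by move=> x _; rewrite big_ord_recr.
by apply: CnD => //; apply: IH.
Qed.

End OpenSet.

(** By the chain rule the partials of the composite are sums of products of
partials of phi with composites of partials of f, which are of order one less. *)
Lemma Cn_comp k l m (U : set 'rV[R]_k) (V : set 'rV[R]_l) f (phi : 'rV[R]_k -> 'rV[R]_l) :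
  open U -> (forall x, U x -> V (phi x)) ->
  (forall j, Cn m U (fun x => phi x 0 j)) -> Cn m V f -> Cn m U (f \o phi).
Proof.
move=> Uo UV; elim: m f => [|m IH] f cphi cf.
  split => // x Ux; apply: differentiable_comp; last exact: Cn_diff cf (UV _ Ux).
  by apply: differentiable_rV => j; exact: Cn_diff (cphi j) Ux.
have dphi x : U x -> differentiable phi x.
  by move=> Ux; apply: differentiable_rV => j; exact: Cn_diff (cphi j) Ux.
split => [x Ux|i].
  by apply: differentiable_comp (dphi _ Ux) _; exact: Cn_diff cf (UV _ Ux).
apply: (@Cn_eq _ _ Uo _ (fun x => \sum_(j < l) (partial j f \o phi) x *
                                  partial i (fun y => phi y 0 j) x)).
  move=> x; rewrite inE => Ux; rewrite partial_comp //; first exact: dphi.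
  exact: Cn_diff cf (UV _ Ux).
apply: Cn_sum => // j; apply: CnM => //.
  by apply: IH => [j'|]; [exact/CnS/cphi|exact: Cn_partial].
exact: (Cn_partial i (cphi j)).
Qed.

Section SmoothOpen.
Variables (k : nat) (U : set 'rV[R]_k).
Hypothesis Uo : open U.
Implicit Types f g : 'rV[R]_k -> R.

Lemma smooth_eq f g : {in U, f =1 g} -> smooth_on U f -> smooth_on U g.
Proof. by move=> fg /smooth_onP sf; apply/smooth_onP => m; exact: (Cn_eq Uo fg). Qed.

Lemma smooth_cst a : smooth_on U (fun=> a).
Proof. by apply/smooth_onP => m; exact: Cn_cst. Qed.

Lemma smoothD f g : smooth_on U f -> smooth_on U g ->
  smooth_on U (fun x => f x + g x).
Proof. by move=> /smooth_onP sf /smooth_onP sg; apply/smooth_onP => m; exact: CnD. Qed.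

Lemma smoothM f g : smooth_on U f -> smooth_on U g ->
  smooth_on U (fun x => f x * g x).
Proof. by move=> /smooth_onP sf /smooth_onP sg; apply/smooth_onP => m; exact: CnM. Qed.

Lemma smoothV f : (forall x, U x -> f x != 0) -> smooth_on U f ->
  smooth_on U (fun x => (f x)^-1).
Proof. by move=> f0 /smooth_onP sf; apply/smooth_onP => m; exact: CnV. Qed.

Lemma smoothB f g : smooth_on U f -> smooth_on U g ->
  smooth_on U (fun x => f x - g x).
Proof.
move=> sf sg; apply: (@smooth_eq (fun x => f x + (-1) * g x)).
  by move=> x _; rewrite mulN1r.
by apply: smoothD => //; apply: smoothM => //; exact: smooth_cst.
Qed.

Lemma smooth_sum (I : Type) (s : seq I) (P : pred I) (f : I -> 'rV[R]_k -> R) :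
  (forall j, P j -> smooth_on U (f j)) ->
  smooth_on U (fun x => \sum_(j <- s | P j) f j x).
Proof.
move=> sf; elim: s => [|j s IH].
  by apply: (@smooth_eq (fun=> 0)) => [x _|]; [rewrite big_nil|exact: smooth_cst].
have [Pj|nPj] := boolP (P j); last first.
  by apply: smooth_eq IH => x _; rewrite big_cons (negbTE nPj).
apply: (@smooth_eq (fun x => f j x + \sum_(j <- s | P j) f j x)).
  by move=> x _; rewrite big_cons Pj.
by apply: smoothD => //; exact: sf.
Qed.

Lemma smooth_prod (I : Type) (s : seq I) (P : pred I) (f : I -> 'rV[R]_k -> R) :
  (forall j, P j -> smooth_on U (f j)) ->
  smooth_on U (fun x => \prod_(j <- s | P j) f j x).
Proof.
move=> sf; elim: s => [|j s IH].
  by apply: (@smooth_eq (fun=> 1)) => [x _|]; [rewrite big_nil|exact: smooth_cst].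
have [Pj|nPj] := boolP (P j); last first.
  by apply: smooth_eq IH => x _; rewrite big_cons (negbTE nPj).
apply: (@smooth_eq (fun x => f j x * \prod_(j <- s | P j) f j x)).
  by move=> x _; rewrite big_cons Pj.
by apply: smoothM => //; exact: sf.
Qed.

Lemma smooth_coord j : smooth_on U (fun x => x 0 j).
Proof.
have dc x : U x -> differentiable (fun x : 'rV[R]_k => x 0 j) x.
  by move=> _; exact: differentiable_coord.
apply/smooth_onP => -[|m]; first by split.
split => // i.
apply: (@Cn_eq _ _ Uo _ (fun=> (j == i)%:R)); last exact: Cn_cst.
by move=> x _; rewrite partial_coord.
Qed.

Lemma smooth_det r (B : 'rV[R]_k -> 'M[R]_r) :
  (forall i j, smooth_on U (fun x => B x i j)) -> smooth_on U (fun x => \det (B x)).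
Proof.
move=> sB; apply: smooth_sum => s _; apply: smoothM; first exact: smooth_cst.
exact: smooth_prod.
Qed.

Lemma smooth_adj r (B : 'rV[R]_k -> 'M[R]_r) i j :
  (forall i j, smooth_on U (fun x => B x i j)) -> smooth_on U (fun x => (\adj (B x)) i j).
Proof.
move=> sB.
apply: (@smooth_eq (fun x => (-1) ^+ (j + i) * \det (row' j (col' i (B x))))).
  by move=> x _; rewrite mxE.
apply: smoothM; first exact: smooth_cst.
apply: smooth_det => i' j'.
by apply: (@smooth_eq (fun x => B x (lift j i') (lift i j'))) => // x _; rewrite !mxE.
Qed.

End SmoothOpen.

Lemma smooth_sub k (U V : set 'rV[R]_k) f : V `<=` U -> smooth_on U f -> smooth_on V f.
Proof. by move=> VU sf s x Vx; exact/sf/VU. Qed.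

Lemma smooth_local k (U : set 'rV[R]_k) f :
  (forall x, U x -> exists V, V x /\ smooth_on V f) -> smooth_on U f.
Proof. by move=> loc s x /loc [V [Vx sf]]; exact: sf. Qed.

Lemma smooth_comp k l (U : set 'rV[R]_k) (V : set 'rV[R]_l) f (phi : 'rV[R]_k -> 'rV[R]_l) :
  open U -> (forall x, U x -> V (phi x)) ->
  smooth_map U phi -> smooth_on V f -> smooth_on U (fun x => f (phi x)).
Proof.
move=> Uo UV sphi /smooth_onP sf; apply/smooth_onP => m.
apply: (Cn_comp Uo UV) => // j.
by have /smooth_onP := sphi j; apply.
Qed.

Lemma smooth_map_diff k l (U : set 'rV[R]_k) (phi : 'rV[R]_k -> 'rV[R]_l) x :
  smooth_map U phi -> U x -> differentiable phi x.
Proof. by move=> sphi Ux; apply: differentiable_rV => j; exact: smooth_diff (sphi j) Ux. Qed.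

End Calculus.

(** * Symmetry of second partial derivatives *)

Section Schwarz.
Local Open Scope classical_set_scope.
Local Open Scope ring_scope.
Context {R : realType}.

Lemma is_derive_line k (f : 'rV[R]_k -> R) x v (s : R) :
  differentiable f (x + s *: v) ->
  is_derive s 1 (fun t => f (x + t *: v)) ('D_v f (x + s *: v)).
Proof.
move=> df; pose g (t : R) := x + t *: v.
have [dg dgE] : is_diff s g (cst 0 + ( *:%R^~ v)).
  by apply: is_diffD.
have dfg : differentiable (f \o g) s by exact: differentiable_comp.
apply: DeriveDef; first exact: diff_derivable.
rewrite deriveE // (diff_comp (f := g) (g := f)) //= dgE.
rewrite -![(_ + _ : _ -> _) _]/(_ + _) /= /cst add0r scale1r deriveE //.
Qed.

(** The mean value theorem twice: along i for the increment of f in direction j,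
then along j for the partial i f.  The left-hand side is symmetric in i and j,
so exchanging them yields the other mixed partial at another nearby point. *)
Lemma second_difference k (U : set 'rV[R]_k) (f : 'rV[R]_k -> R) x i j (h : R) :
  smooth_on U f -> 0 < h ->
  (forall s t, 0 <= s <= h -> 0 <= t <= h ->
     U (x + s *: delta_mx 0 i + t *: delta_mx 0 j)) ->
  exists s t, [/\ 0 <= s <= h, 0 <= t <= h &
    f (x + h *: delta_mx 0 i + h *: delta_mx 0 j) - f (x + h *: delta_mx 0 i)
      - f (x + h *: delta_mx 0 j) + f x =
    h * h * partial j (partial i f) (x + s *: delta_mx 0 i + t *: delta_mx 0 j)].
Proof.
set ei := delta_mx 0 i; set ej := delta_mx 0 j => sf h0 inU.
have h00 : 0 <= (0 : R) <= h by rewrite lexx ltW.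
have hh : 0 <= h <= h by rewrite lexx ltW.
have U' s : 0 <= s <= h -> U (x + s *: ei).
  by move=> /inU /(_ h00); rewrite scale0r addr0.
have U'' s : 0 <= s <= h -> U (x + h *: ej + s *: ei).
  by move=> /inU /(_ hh); rewrite addrAC.
pose G s := f (x + h *: ej + s *: ei) - f (x + s *: ei).
pose dG s := partial i f (x + h *: ej + s *: ei) - partial i f (x + s *: ei).
have dGP s : 0 <= s <= h -> is_derive s 1 G (dG s).
  by move=> s0h; apply: is_deriveB; apply: is_derive_line; apply: smooth_diff sf _;
     [exact: U''|exact: U'].
have itvP (s : R) : s \in `]0, h[%R -> 0 <= s <= h.
  by rewrite in_itv /= => /andP[? ?]; rewrite !ltW.
have [||c /itvP c0h] := @MVT _ G dG 0 h h0.
- by move=> s /itvP; exact: dGP.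
- apply: derivable_within_continuous => s; rewrite in_itv /= => /dGP.
  by case.
rewrite /G /dG !scale0r !addr0 subr0 => GE.
pose K t := partial i f (x + c *: ei + t *: ej).
pose dK t := partial j (partial i f) (x + c *: ei + t *: ej).
have dKP t : 0 <= t <= h -> is_derive t 1 K (dK t).
  move=> t0h; apply: is_derive_line; apply: smooth_diff (smooth_partial i sf) _.
  exact: inU.
have [||c' /itvP c'0h] := @MVT _ K dK 0 h h0.
- by move=> s /itvP; exact: dKP.
- apply: derivable_within_continuous => s; rewrite in_itv /= => /dKP.
  by case.
rewrite /K /dK !scale0r !addr0 subr0 => KE.
exists c, c'; split => //.
rewrite -mulrA [h * partial _ _ _]mulrC -KE (addrAC x (c *: ei)).
rewrite [RHS]mulrC -GE (addrAC x (h *: ei)); ring.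
Qed.

Lemma continuous_dist_near k (f : 'rV[R]_k -> R) x (e : R) :
  {for x, continuous f} -> 0 < e -> \forall y \near x, `|f x - f y| < e.
Proof. by move=> /cvgrPdist_lt cf e0; exact: cf. Qed.

(** Schwarz's theorem: by second_difference the two continuous mixed partials
take a common value at points of arbitrarily small squares at x. *)
Lemma partialC k (U : set 'rV[R]_k) (f : 'rV[R]_k -> R) x i j :
  open U -> smooth_on U f -> U x ->
  partial i (partial j f) x = partial j (partial i f) x.
Proof.
have half_sum (u v w e : R) : v < e / 2 -> w < e / 2 -> u <= v + w -> u <= e by lra.
move=> Uo sf Ux; apply/eqP; rewrite -subr_eq0 -normr_eq0; apply/eqP/le_anti.
rewrite normr_ge0 andbT; apply/ler_addgt0Pl => e' e0'; rewrite addr0.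
pose e : R := e'; have e0 : 0 < e := e0'; rewrite -/e; move: e e0 => {e' e0'} e e0.
have cont a b : {for x, continuous (partial a (partial b f))}.
  apply: differentiable_continuous; apply: smooth_diff (Ux).
  exact/smooth_partial/smooth_partial.
have e2 : 0 < e / 2 by rewrite divr_gt0.
have near_x : \forall y \near x, [/\ U y,
    `|partial i (partial j f) x - partial i (partial j f) y| < e / 2
  & `|partial j (partial i f) x - partial j (partial i f) y| < e / 2].
  apply: filterS3 (open_near Uo Ux) (continuous_dist_near (cont i j) e2)
    (continuous_dist_near (cont j i) e2) => y Uy yij yji;
  split; [exact: Uy|exact: yij|exact: yji].
have [r /= r0 ball_r] := (nbhs_normP _ _).1 near_x.
set ei : 'rV[R]_k := delta_mx 0 i; set ej : 'rV[R]_k := delta_mx 0 j.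
(* h is chosen so that the square of side h at x stays in the ball of radius r. *)
pose C := `|ei| + `|ej| + 1.
have C0 : 0 < C by rewrite ltr_wpDl // addr_ge0.
pose h := r / (C + C).
have h0 : 0 < h by rewrite divr_gt0 // addr_gt0.
have in_ball s t a b : 0 <= s <= h -> 0 <= t <= h ->
    `|a| <= `|ei| -> `|b| <= `|ej| -> ball_ Num.norm x r (x + s *: a + t *: b).
  move=> /andP[s0 sh] /andP[t0 th] ha hb.
  rewrite /ball_ /= -addrA opprD addrA subrr sub0r normrN.
  apply: (@le_lt_trans _ _ (h * `|ei| + h * `|ej|)).
    rewrite (le_trans (ler_normD _ _)) // !normrZ (ger0_norm s0) (ger0_norm t0).
    by rewrite lerD // ler_pM.
  apply: (@lt_le_trans _ _ (h * C)); first by rewrite -mulrDr ltr_pM2l // ltrDl.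
  have -> : h * C = r / 2.
    by rewrite /h; field; rewrite -mulr2n mulrn_eq0 negb_or /= gt_eqF.
  by rewrite ler_pdivrMr // ler_peMr ?ltW // ltr1n.
have Ub s t a b : 0 <= s <= h -> 0 <= t <= h ->
    `|a| <= `|ei| -> `|b| <= `|ej| -> _ := fun s0 t0 a0 b0 =>
    ball_r _ (in_ball s t a b s0 t0 a0 b0).
have [|s [t [s0h t0h E1]]] := @second_difference _ U f x i j h sf h0.
  by move=> a b a0h b0h; have [] := Ub a b _ _ a0h b0h (lexx _) (lexx _).
have [|t' [s' [t'0h s'0h E2]]] := @second_difference _ U f x j i h sf h0.
  by move=> a b a0h b0h; rewrite addrAC; have [] := Ub b a _ _ b0h a0h (lexx _) (lexx _).
have [_ _ Bji] := Ub s t _ _ s0h t0h (lexx _) (lexx _).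
have [_ Bij _] := Ub s' t' _ _ s'0h t'0h (lexx _) (lexx _).
have hh : h * h != 0 by rewrite mulf_neq0 // gt_eqF.
have E : h * h * partial i (partial j f) (x + s' *: ei + t' *: ej) =
         h * h * partial j (partial i f) (x + s *: ei + t *: ej).
  rewrite (addrAC x (s' *: ei)); apply: etrans (esym E2) _; apply: etrans _ E1.
  by rewrite (addrAC x (h *: delta_mx 0 j)); ring.
have {E hh} := mulfI hh E.
move: Bij Bji.
set c := partial _ _ (x + s' *: ei + t' *: ej); set c' := partial _ _ (_ + _ + _).
move: c c' (partial i _ x) (partial j _ x) => c c' a b ac + cc'; rewrite -{c'}cc' => bc.
have := ler_normD (a - c) (c - b).
by rewrite addrA subrK [`|c - b|]distrC; exact: half_sum.
Qed.

End Schwarz.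

(** * Flat functions *)

Section Bump.
Local Open Scope classical_set_scope.
Local Open Scope ring_scope.
Context {R : realType}.

(** With the extra factor t^-m the derivatives of exp(-1/t) stay in the span of
the family, so that a single induction over the order of differentiation, for
all m at once, shows that these functions are smooth. *)
Definition flat (m : nat) (t : R) : R :=
  if 0 < t then expR (- t^-1) * t^-1 ^+ m else 0.

(** With k = m+2 one has exp(1/t) = exp(1/(kt))^k >= (1/(kt))^k.  The power m+2
leaves a factor t^2, which makes the difference quotients at 0 tend to 0. *)
Lemma flat_bound m t : `|flat m t| <= m.+2%:R ^+ m.+2 * t ^+ 2.
Proof.
rewrite /flat; case: ifPn => [t0|_]; last first.
  by rewrite normr0; apply: mulr_ge0; [exact: exprn_ge0|exact: sqr_ge0].
have ti0 : 0 < t^-1 by rewrite invr_gt0.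
rewrite ger0_norm; last by rewrite mulr_ge0 ?expR_ge0 ?exprn_ge0 // ltW.
have k0 : 0 < m.+2%:R :> R by rewrite ltr0n.
pose s := (m.+2%:R * t)^-1.
have s0 : 0 < s by rewrite invr_gt0 mulr_gt0.
have -> : - t^-1 = m.+2%:R * - s.
  by rewrite /s invfM mulrN mulrA divff ?mul1r // gt_eqF.
rewrite expRM_natl expRN.
have le1 : (expR s)^-1 <= m.+2%:R * t.
  rewrite -[leRHS]invrK lef_pV2 ?posrE ?expR_gt0 //.
  by apply: le_trans (expR_ge1Dx s); rewrite lerDr.
have : (expR s)^-1 ^+ m.+2 * t^-1 ^+ m <= (m.+2%:R * t) ^+ m.+2 * t^-1 ^+ m.
  rewrite ler_wpM2r ?exprn_ge0 ?(ltW ti0) // lerXn2r // nnegrE.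
    by rewrite invr_ge0 expR_ge0.
  by rewrite mulr_ge0 ?ltW.
move=> /le_trans; apply; rewrite exprMn -mulrA ler_wpM2l ?exprn_ge0 //.
by rewrite -addn2 exprD mulrAC exprVn divff ?mul1r // expf_neq0 // gt_eqF.
Qed.

Lemma is_derive_flat m (t : R) :
  is_derive t 1 (flat m) (flat m.+2 t - m%:R * flat m.+1 t).
Proof.
have [t0|t0|->] := ltgtP t 0.
- have nearE : \near t, 0 = flat m t.
    apply: filterS (open_nbhs_nbhs (conj (@open_lt R 0) t0)) => s /= s0.
    by rewrite /flat (lt_gtF s0).
  rewrite [X in is_derive _ _ _ X](_ : _ = 0).
    by apply: near_eq_is_derive nearE _; exact: is_derive_cst.
  by rewrite /flat (lt_gtF t0) mulr0 subrr.
- have nearE : \near t, expR (- t^-1) * t^-1 ^+ m = flat m t.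
    by apply: filterS (open_nbhs_nbhs (conj (@open_gt R 0) t0)) => s /= s0; rewrite /flat s0.
  apply: near_eq_is_derive nearE _; rewrite /flat t0.
  have t_neq0 : t != 0 by rewrite gt_eqF.
  have dV : is_derive t 1 (fun s : R => s^-1) (- t^-1 ^+ 2).
    apply: DeriveDef; first exact: derivableV.
    by rewrite (@deriveV _ _ id) // derive_id /GRing.scale /= mulr1 exprVn.
  have dN : is_derive t 1 (fun s : R => - s^-1) (t^-1 ^+ 2).
    by rewrite -[X in is_derive _ _ _ X]opprK; exact: is_deriveN.
  have dE : is_derive t 1 (fun s : R => expR (- s^-1)) (expR (- t^-1) * t^-1 ^+ 2).
    exact: (is_derive1_comp (f := expR)).
  have dX : is_derive t 1 (fun s : R => s^-1 ^+ m) (- (m%:R * t^-1 ^+ m.+1)).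
    case: (m) => [|m'].
      by rewrite mul0r oppr0; under eq_fun do rewrite expr0; exact: is_derive_cst.
    have := @is_deriveX _ _ (fun s : R => s^-1) m'.+1 t 1 _ dV.
    rewrite (_ : (fun s : R => s^-1) ^+ m'.+1 = (fun s : R => s^-1 ^+ m'.+1)); last first.
      by apply/funext => s; rewrite fctE.
    by move=> dX; apply: (is_derive_eq dX); rewrite /GRing.scale /= !exprS; ring.
  by apply: (is_derive_eq (is_deriveM dE dX)); rewrite /GRing.scale /= !exprS; ring.
- rewrite [X in is_derive _ _ _ X](_ : _ = 0); last by rewrite /flat ltxx mulr0 subrr.
  have flat0 : flat m 0 = 0 by rewrite /flat ltxx.
  have cvg0 : h^-1 *: ((flat m \o shift 0) (h *: 1) - flat m 0) @[h --> (0 : R)^'] --> 0.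
    apply/cvgrPdist_le => e e0.
    pose C : R := m.+2%:R ^+ m.+2.
    have C0 : 0 < C by rewrite exprn_gt0.
    near=> h.
    have h0 : h != 0 by near: h; exact: nbhs_dnbhs_neq.
    rewrite sub0r normrN flat0 subr0 /= addr0 normrZ normfV.
    rewrite ler_pdivrMl ?normr_gt0 // /GRing.scale /= mulr1.
    apply: le_trans (flat_bound m h) _; rewrite -/C -real_normK ?num_real // expr2.
    rewrite mulrCA ler_wpM2l // mulrC -ler_pdivlMr //.
    by near: h; apply: dnbhs0_le; rewrite divr_gt0.
  by apply: DeriveDef; [apply/cvg_ex; exists 0|exact: cvg_lim cvg0].
Unshelve. all: by end_near. Qed.

Lemma flat_gt0 m t : 0 < t -> 0 < flat m t.
Proof. by move=> t0; rewrite /flat t0 mulr_gt0 ?expR_gt0 // exprn_gt0 // invr_gt0. Qed.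

Lemma smooth_flat k m (U : set 'rV[R]_k) (l : 'rV[R]_k -> R) :
  open U -> smooth_on U l -> smooth_on U (fun x => flat m (l x)).
Proof.
move=> Uo sl; apply/smooth_onP => r; elim: r m => [|r IH] m.
  split => // x Ux; apply: (@differentiable_comp _ _ _ _ l (flat m)).
    exact: smooth_diff sl Ux.
  by apply/derivable1_diffP; have [] := is_derive_flat m (l x).
have dflat x : U x -> differentiable (fun x => flat m (l x)) x.
  move=> Ux; apply: (@differentiable_comp _ _ _ _ l (flat m)).
    exact: smooth_diff sl Ux.
  by apply/derivable1_diffP; have [] := is_derive_flat m (l x).
split => // i.
apply: (@Cn_eq _ _ _ Uo _ (fun x =>
    (flat m.+2 (l x) + (- m%:R) * flat m.+1 (l x)) * partial i l x)).
  move=> x; rewrite inE => Ux.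
  have dl := smooth_diff sl Ux.
  have [df dfE] := is_derive_flat m (l x).
  have df' : differentiable (flat m) (l x) by exact/derivable1_diffP.
  rewrite [RHS]partialE; last exact: dflat.
  rewrite (diff_comp (f := l) (g := flat m)) //= -partialE //.
  have -> : 'd (flat m) (l x) (partial i l x) = partial i l x *: 'd (flat m) (l x) 1.
    by rewrite -linearZ; congr ('d _ _ _); rewrite /GRing.scale /= mulr1.
  rewrite -deriveE // dfE.
  by rewrite /GRing.scale /= mulNr; ring.
apply: CnM => //; last by have /smooth_onP := smooth_partial i sl; apply.
by apply: CnD => //; apply: CnM => //; exact: Cn_cst.
Qed.

End Bump.

(** * Changes of chart for vectors, vector fields and 1-forms *)

Local Notation image_of c U := (cfun c @` (cdom c `&` U))%classic.

Section Charts.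
Local Open Scope classical_set_scope.
Local Open Scope ring_scope.
Context {R : realType} {d : nat} {M : smooth_manifold R d}.
Implicit Types (c : chart R d M) (p : M).

Lemma cfunKp c p : cdom c p -> cinv c (cfun c p) = p.
Proof. by move=> cp; have := @cfunK _ _ _ c => /(_ p); rewrite inE; exact. Qed.

Lemma image_ofP c (U : set M) (x : 'rV[R]_d) :
  image_of c U x <-> (cfun c @` cdom c) x /\ U (cinv c x).
Proof.
split=> [[p [cp Up] <-]|[[p cp <-]]]; (rewrite cfunKp; last exact: cp).
  by split => //; exists p.
by move=> Up; exists p.
Qed.

Lemma image_ofT c : image_of c setT = cfun c @` cdom c.
Proof. by rewrite setIT. Qed.

Lemma cinv_continuousP c x : (cfun c @` cdom c) x -> {for x, continuous (cinv c)}.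
Proof.
move=> cx; have := @cinv_continuous _ _ _ c.
by rewrite continuous_open_subspace; [move=> /(_ x); rewrite inE; exact|exact: cimg_open].
Qed.

Lemma cfun_continuousP c p : cdom c p -> {for p, continuous (cfun c)}.
Proof.
move=> cp; have := @cfun_continuous _ _ _ c.
by rewrite continuous_open_subspace; [move=> /(_ p); rewrite inE; exact|exact: cdom_open].
Qed.

Lemma image_of_open c (U : set M) : open U -> open (image_of c U).
Proof.
move=> Uo; rewrite openE => x /image_ofP [cx Ux]; rewrite /interior.
have n1 := open_nbhs_nbhs (conj (@cimg_open _ _ _ c) cx).
have n2 : nbhs x (cinv c @^-1` U).
  by apply: (cinv_continuousP cx); exact: open_nbhs_nbhs.
by apply: filterS2 n1 n2 => y cy Uy; apply/image_ofP.
Qed.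

Definition dtrans c c' p (v : 'rV[R]_d) : 'rV[R]_d :=
  'd (cfun c' \o cinv c) (cfun c p) v.

(** Vectors are rows, so the differential of the transition from c to c' is
multiplication on the right by this matrix (dtransE). *)
Definition jac c c' p : 'M[R]_d :=
  \matrix_(i, l) partial i (fun y => cfun c' (cinv c y) 0 l) (cfun c p).

Section Transitions.
Variables (c c' : chart R d M) (p : M).
Hypotheses (ac : atlas c) (ac' : atlas c') (cp : cdom c p) (cp' : cdom c' p).

Lemma transition_smooth : smooth_map (image_of c (cdom c')) (cfun c' \o cinv c).
Proof. by have [] := atlas_compatible ac ac'. Qed.

Lemma image_of_mem : image_of c (cdom c') (cfun c p).
Proof. by exists p. Qed.

Lemma transition_diff : differentiable (cfun c' \o cinv c) (cfun c p).
Proof. exact: smooth_map_diff transition_smooth image_of_mem. Qed.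

Lemma dtransE v : dtrans c c' p v = v *m jac c c' p.
Proof.
apply/rowP => l; rewrite /dtrans diff_rVE; last exact: transition_diff.
rewrite diff_partial; last exact/differentiable_coordf/transition_diff.
by rewrite mxE; apply: eq_bigr => i _; rewrite mxE.
Qed.

End Transitions.

(** The transition maps satisfy the cocycle condition near p, and the chain rule
passes it on to their differentials. *)
Lemma jac_comp c c' c'' p : atlas c -> atlas c' -> atlas c'' ->
  cdom c p -> cdom c' p -> cdom c'' p ->
  jac c c' p *m jac c' c'' p = jac c c'' p.
Proof.
move=> ac ac' ac'' cp cp' cp''; apply/row_matrixP => i.
rewrite !rowE mulmxA -!dtransE // /dtrans.
have E : cfun c' p = (cfun c' \o cinv c) (cfun c p) by rewrite /= cfunKp.
have d1 := transition_diff ac ac' cp cp'.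
have d2 := transition_diff ac' ac'' cp' cp''.
rewrite E in d2 *.
have dE := diff_comp d1 d2.
rewrite -[LHS]/((_ \o _) _) -dE.
have oo := image_of_open (c := c) (@cdom_open _ _ _ c').
have near_E : {near cfun c p, (cfun c'' \o cinv c') \o (cfun c' \o cinv c) =1
    cfun c'' \o cinv c}.
  apply: filterS (open_near oo (image_of_mem cp cp')) => y /image_ofP [_ cy] /=.
  by rewrite cfunKp.
have [_ dE'] := near_eq_diff near_E (differentiable_comp d1 d2).
exact: (congr1 (fun h => h (delta_mx 0 i)) (esym dE')).
Qed.

Lemma jac_id c p : cdom c p -> jac c c p = 1%:M.
Proof.
move=> cp; apply/matrixP => i l; rewrite !mxE.
rewrite (@near_eq_partial _ _ _ (fun y => y 0 l)) ?partial_coord 1?eq_sym //.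
apply: filterS (open_near (@cimg_open _ _ _ c) (imageP _ cp)) => _ [q cq <-].
by rewrite cfunKp.
Qed.

Lemma tcoordE c p v : atlas c -> cdom c p -> tcoord c p v = v *m jac (chart_at p) c p.
Proof. by move=> ac cp; rewrite -dtransE //; [exact: chart_at_atlas|exact: chart_at_dom]. Qed.

Lemma tvecE c p v : atlas c -> cdom c p -> tvec c p v = v *m jac c (chart_at p) p.
Proof. by move=> ac cp; rewrite -dtransE //; [exact: chart_at_atlas|exact: chart_at_dom]. Qed.

Lemma tvecK c p v : atlas c -> cdom c p -> tcoord c p (tvec c p v) = v.
Proof.
move=> ac cp; rewrite tcoordE // tvecE // -mulmxA jac_comp ?jac_id ?mulmx1 //.
  exact: chart_at_atlas.
exact: chart_at_dom.
Qed.

Lemma tcoordK c p v : atlas c -> cdom c p -> tvec c p (tcoord c p v) = v.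
Proof.
move=> ac cp; rewrite tcoordE // tvecE // -mulmxA jac_comp ?jac_id ?mulmx1 //;
  by [exact: chart_at_atlas|exact: chart_at_dom].
Qed.

Lemma tcoord_chart_at p v : tcoord (chart_at p) p v = v.
Proof.
rewrite tcoordE ?jac_id ?mulmx1 //; by [exact: chart_at_dom|exact: chart_at_atlas].
Qed.

Lemma tcoord_change c c' p v : atlas c -> atlas c' -> cdom c p -> cdom c' p ->
  tcoord c' p v = tcoord c p v *m jac c c' p.
Proof.
move=> ac ac' cp cp'; rewrite !tcoordE // -mulmxA jac_comp //;
  by [exact: chart_at_atlas|exact: chart_at_dom].
Qed.

Lemma tvec_change c c' p v : atlas c -> atlas c' -> cdom c p -> cdom c' p ->
  tvec c p v = tvec c' p (v *m jac c c' p).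
Proof.
move=> ac ac' cp cp'; rewrite !tvecE // -mulmxA jac_comp //;
  by [exact: chart_at_atlas|exact: chart_at_dom].
Qed.

Lemma smooth_jac c c' i l : atlas c -> atlas c' ->
  smooth_on (image_of c (cdom c')) (fun x => jac c c' (cinv c x) i l).
Proof.
move=> ac ac'.
have oo := image_of_open (c := c) (@cdom_open _ _ _ c').
apply: (smooth_eq oo (f := partial i (fun y => cfun c' (cinv c y) 0 l))).
  by move=> x; rewrite inE => -[q [cq _] <-]; rewrite mxE cfunKp.
by apply: smooth_partial; exact: (transition_smooth ac ac').
Qed.

Lemma linear_on0 (D : set 'rV[R]_d) (f : 'rV[R]_d -> R) :
  linear_on D f -> D 0 -> f 0 = 0.
Proof.
move=> lf D0; have := lf 1 0 0 D0 D0; rewrite scaler0 addr0 mul1r.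
by move=> /eqP; rewrite -subr_eq subrr eq_sym => /eqP.
Qed.

Lemma linear_on_sum (f : 'rV[R]_d -> R) (m : nat) (u : 'I_m -> 'rV[R]_d)
    (b : 'I_m -> R) : linear_on setT f ->
  f (\sum_(i < m) b i *: u i) = \sum_(i < m) b i * f (u i).
Proof.
move=> lf; elim/big_rec2: _ => [|i r v _ <-]; first exact: (linear_on0 lf).
by rewrite lf.
Qed.

Section Forms.
Variables (a : one_form M) (c : chart R d M) (p : M).
Hypotheses (la : linear_on setT (a p)) (ac : atlas c) (cp : cdom c p).

Lemma form_tvec (w : 'rV[R]_d) :
  a p (tvec c p w) = \sum_k w 0 k * fcoef c a k (cfun c p).
Proof.
rewrite tvecE // {1}[w]row_sum_delta mulmx_suml.
under eq_bigr do rewrite -scalemxAl -tvecE //.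
rewrite (linear_on_sum (f := a p) (fun i => tvec c p (delta_mx 0 i))
  (fun i => w 0 i) la); apply: eq_bigr => i _.
by rewrite /fcoef cfunKp.
Qed.

Lemma form_tcoord v : a p v = \sum_k tcoord c p v 0 k * fcoef c a k (cfun c p).
Proof. by rewrite -form_tvec tcoordK. Qed.

(** The coefficients of a 1-form are covariant: the basis vector i of c' has
components jac c' c p i in c. *)
Lemma fcoef_change c' i : atlas c' -> cdom c' p ->
  fcoef c' a i (cfun c' p) = \sum_k jac c' c p i k * fcoef c a k (cfun c p).
Proof.
move=> ac' cp'; rewrite {1}/fcoef cfunKp // (tvec_change _ ac' ac) // form_tvec.
by apply: eq_bigr => k _; rewrite -rowE mxE.
Qed.

End Forms.

Lemma smooth_fcoef_transfer (a : one_form M) c c' (V : set M) i :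
  atlas c -> atlas c' -> open V -> (forall q, V q -> linear_on setT (a q)) ->
  (forall j, smooth_on (image_of c V) (fcoef c a j)) ->
  smooth_on (image_of c' (cdom c `&` V)) (fcoef c' a i).
Proof.
move=> ac ac' Vo la sa.
have Wo : open (image_of c' (cdom c `&` V)).
  by apply: image_of_open; apply: openI => //; exact: cdom_open.
apply: (smooth_eq Wo (f := fun x => \sum_k jac c' c (cinv c' x) i k *
    fcoef c a k (cfun c (cinv c' x)))).
  move=> x; rewrite inE => -[q [cq [cq' Vq]] <-]; rewrite cfunKp //.
  by rewrite -fcoef_change //; exact: la.
apply: smooth_sum => // k _; apply: smoothM => //.
  apply: smooth_sub (smooth_jac i k ac' ac) => x [q [cq [cq' Vq]] <-].
  by exists q.
apply: smooth_comp (sa k) => //.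
  by move=> x [q [cq [cq' Vq]] <-]; rewrite cfunKp //; exists q.
move=> j; apply: smooth_sub (transition_smooth ac' ac j) => x [q [cq [cq' Vq]] <-].
by exists q.
Qed.

(** Near each point a single chart suffices, since the coefficients in any other
chart are combinations of these with smooth factors (fcoef_change).  Adapted
charts and preferred charts can therefore be used interchangeably. *)
Lemma smooth_1form_local (a : one_form M) :
  (forall p, linear_on setT (a p)) ->
  (forall p, exists c V, [/\ atlas c, open V, cdom c p, V p
     & forall j, smooth_on (image_of c V) (fcoef c a j)]) ->
  smooth_1form setT a.
Proof.
move=> la loc; split => [p _|c' ac' i]; first exact: la.
apply: smooth_local => x [p [cp' _] <-].
have [c [V [ac Vo cp Vp sa]]] := loc p.
exists (image_of c' (cdom c `&` V)); split; first by exists p.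
by apply: smooth_fcoef_transfer sa.
Qed.

Lemma vcoef_change (X : vfield M) c c' p i :
  atlas c -> atlas c' -> cdom c p -> cdom c' p ->
  vcoef c' X i (cfun c' p) = \sum_k vcoef c X k (cfun c p) * jac c c' p k i.
Proof.
move=> ac ac' cp cp'; rewrite /vcoef !cfunKp // (tcoord_change _ ac ac') //.
by rewrite mxE.
Qed.

Lemma smooth_vcoef_transfer (X : vfield M) c c' (V : set M) i :
  atlas c -> atlas c' -> open V ->
  (forall j, smooth_on (image_of c V) (vcoef c X j)) ->
  smooth_on (image_of c' (cdom c `&` V)) (vcoef c' X i).
Proof.
move=> ac ac' Vo sX.
have Wo : open (image_of c' (cdom c `&` V)).
  by apply: image_of_open; apply: openI => //; exact: cdom_open.
have sphi : smooth_map (image_of c' (cdom c `&` V)) (cfun c \o cinv c').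
  move=> j; apply: smooth_sub (transition_smooth ac' ac j) => x [q [cq [cq' Vq]] <-].
  by exists q.
apply: (smooth_eq Wo (f := fun x => \sum_k
    vcoef c X k ((cfun c \o cinv c') x) *
    jac c c' (cinv c ((cfun c \o cinv c') x)) k i)).
  move=> x; rewrite inE => -[q [cq [cq' Vq]] <-].
  by rewrite (vcoef_change _ _ ac ac' cq' cq) /= !cfunKp.
apply: smooth_sum => // k _; apply: smoothM => //.
  apply: smooth_comp sphi (sX k) => //.
  by move=> x [q [cq [cq' Vq]] <-] /=; rewrite cfunKp //; exists q.
apply: smooth_comp sphi (smooth_jac k i ac ac') => //.
by move=> x [q [cq [cq' Vq]] <-] /=; rewrite cfunKp //; exists q.
Qed.

Lemma smooth_vfield_local (X : vfield M) :
  (forall p, exists c V, [/\ atlas c, open V, cdom c p, V p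
     & forall j, smooth_on (image_of c V) (vcoef c X j)]) ->
  smooth_vfield X.
Proof.
move=> loc c' ac' i; apply: smooth_local => x [p cp' <-].
have [c [V [ac Vo cp Vp sa]]] := loc p.
exists (image_of c' (cdom c `&` V)); split; first by exists p.
by apply: smooth_vcoef_transfer sa.
Qed.

End Charts.

(** * The exterior derivative of a 1-form in charts *)

Section ExteriorDerivative.
Local Open Scope classical_set_scope.
Local Open Scope ring_scope.
Context {R : realType} {d : nat} {M : smooth_manifold R d}.
Implicit Types (c : chart R d M) (p : M) (a : one_form M).

(** The components of the 2-form d a in the chart c. *)
Definition dmat c a p : 'M[R]_d :=
  \matrix_(i, j) (partial i (fcoef c a j) (cfun c p)
                  - partial j (fcoef c a i) (cfun c p)).

Definition frow c a p : 'rV[R]_d := \row_i fcoef c a i (cfun c p).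

Lemma dmat_anti c a p : (dmat c a p)^T = - dmat c a p.
Proof. by apply/matrixP => i j; rewrite !mxE opprB. Qed.

Lemma ext_derivE a p v w :
  ext_deriv a p v w = (v *m dmat (chart_at p) a p *m w^T) 0 0.
Proof.
rewrite /ext_deriv mxE exchange_big; apply: eq_bigr => j _ /=.
rewrite !mxE mulr_suml; apply: eq_bigr => i _; rewrite !mxE.
by rewrite [in RHS]mulrC mulrA mulrC [w 0 j * _]mulrC -!mulrA; congr (_ * _); rewrite mulrC.
Qed.

Lemma formE c a p v : linear_on setT (a p) -> atlas c -> cdom c p ->
  a p v = (tcoord c p v *m (frow c a p)^T) 0 0.
Proof.
move=> la ac cp; rewrite (form_tcoord la ac) // mxE.
by apply: eq_bigr => k _; rewrite !mxE.
Qed.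

(** Differentiating the transformation rule of the coefficients produces, besides
the transformed first derivatives, a term with the Hessians of the transition
map; it is symmetric in i and j, so it drops out of the antisymmetrization. *)
Lemma dmat_change c c' a (U : set M) p : smooth_1form U a -> open U -> U p ->
  atlas c -> atlas c' -> cdom c p -> cdom c' p ->
  dmat c a p = jac c c' p *m dmat c' a p *m (jac c c' p)^T.
Proof.
move=> [la sa] Uo Up ac ac' cp cp'.
pose phi := cfun c' \o cinv c.
set W := image_of c (cdom c' `&` U).
have Wo : open W by apply: image_of_open; apply: openI => //; exact: cdom_open.
have Wp : W (cfun c p) by exists p.
have sphi l : smooth_on W (fun y => phi y 0 l).
  by apply: smooth_sub (transition_smooth ac ac' l) => _ [q [cq [cq' _]] <-]; exists q.
pose g k := fcoef c' a k.
have sg k : smooth_on (image_of c' U) (g k) by exact: sa.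
have sgphi k : smooth_on W (fun y => g k (phi y)).
  apply: smooth_comp sphi (sg k) => // _ [q [cq [cq' Uq]] <-]; rewrite /phi /=.
  by rewrite cfunKp //; exists q.
have Ug : image_of c' U (phi (cfun c p)) by rewrite /phi /= cfunKp //; exists p.
have coefE j : {in W, fcoef c a j =1 fun y =>
    \sum_k partial j (fun z => phi z 0 k) y * g k (phi y)}.
  move=> y; rewrite inE => -[q [cq [cq' Uq]] <-].
  rewrite (fcoef_change (la q Uq) ac' cq' j ac cq); apply: eq_bigr => k _.
  by rewrite mxE /g /phi /= cfunKp.
(* H holds the Hessians of the components of phi; it is symmetric in i and j. *)
pose H i j k := partial i (partial j (fun z => phi z 0 k)) (cfun c p).
pose G := \matrix_(l, k) partial l (g k) (cfun c' p).
have partial_coef i j : partial i (fcoef c a j) (cfun c p) =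
    (jac c c' p *m G *m (jac c c' p)^T) i j + \sum_k H i j k * g k (cfun c' p).
  rewrite (near_eq_partial _ (eq_on_near Wo (coefE j) Wp)).
  rewrite partial_sum; last first.
    move=> k; apply: differentiableM; first exact: smooth_diff (smooth_partial j (sphi k)) Wp.
    exact: smooth_diff (sgphi k) Wp.
  rewrite mxE -big_split /=; apply: eq_bigr => k _.
  rewrite partialM; last 2 first.
  - exact: smooth_diff (smooth_partial j (sphi k)) Wp.
  - exact: smooth_diff (sgphi k) Wp.
  rewrite (partial_comp (f := g k)); last 2 first.
  - by apply: smooth_map_diff Wp; exact: sphi.
  - exact: smooth_diff (sg k) Ug.
  have phiE : phi (cfun c p) = cfun c' p by rewrite /phi /= cfunKp.
  rewrite phiE [g k _ * _]mulrC; congr (_ + _).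
  rewrite !mxE mulrC; congr (_ * _); apply: eq_bigr => l _.
  by rewrite !mxE mulrC.
have -> : dmat c' a p = G - G^T by apply/matrixP => i j; rewrite !mxE.
have HC i j k : H i j k = H j i k by exact: (partialC i j Wo (sphi k) Wp).
apply/matrixP => i j; rewrite mxE !partial_coef.
under [in X in _ - (_ + X)]eq_bigr do rewrite HC.
rewrite opprD addrACA subrr addr0 mulmxBr mulmxBl.
rewrite [RHS]mxE [X in _ = _ + X]mxE; congr (_ - _).
set P := jac c c' p.
have -> : P *m G^T *m P^T = (P *m G *m P^T)^T by rewrite !trmx_mul trmxK mulmxA.
by rewrite [RHS]mxE.
Qed.

Lemma ext_deriv_chart c a (U : set M) p v w :
  smooth_1form U a -> open U -> U p -> atlas c -> cdom c p ->
  ext_deriv a p v w = (tcoord c p v *m dmat c a p *m (tcoord c p w)^T) 0 0.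
Proof.
move=> sa Uo Up ac cp; have ap := @chart_at_atlas _ _ M p.
have cpp := @chart_at_dom _ _ M p.
rewrite ext_derivE (dmat_change sa Uo Up ap ac) // !tcoordE //.
by rewrite trmx_mul !mulmxA.
Qed.

Lemma smooth_dmat c a (U : set M) i j : smooth_1form U a -> open U -> atlas c ->
  smooth_on (image_of c U) (fun x => dmat c a (cinv c x) i j).
Proof.
move=> [_ sa] Uo ac; have Wo := image_of_open (c := c) Uo.
apply: (smooth_eq Wo (f := fun x => partial i (fcoef c a j) x - partial j (fcoef c a i) x)).
  by move=> x; rewrite inE => -[q [cq _] <-]; rewrite mxE cfunKp.
by apply: smoothB => //; apply: smooth_partial; exact: sa.
Qed.

Lemma smooth_frow c a (U : set M) i : smooth_1form U a -> open U -> atlas c ->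
  smooth_on (image_of c U) (fun x => frow c a (cinv c x) 0 i).
Proof.
move=> [_ sa] Uo ac; have Wo := image_of_open (c := c) Uo.
apply: (smooth_eq Wo (f := fcoef c a i)); last exact: sa.
by move=> x; rewrite inE => -[q [cq _] <-]; rewrite mxE cfunKp.
Qed.

(** The Leibniz rule d (f b) = f db + df /\ b; the last two summands vanish on
pairs of vectors from the kernel of b. *)
Lemma dmat_scale c a b (f : 'rV[R]_d -> R) p :
  {near cfun c p, forall x, forall j, fcoef c a j x = f x * fcoef c b j x} ->
  differentiable f (cfun c p) ->
  (forall j, differentiable (fcoef c b j) (cfun c p)) ->
  let g := \row_i partial i f (cfun c p) in
  dmat c a p = f (cfun c p) *: dmat c b p + g^T *m frow c b p - (frow c b p)^T *m g.
Proof.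
move=> E df db g; apply/matrixP => i j.
have pE i' j' : partial i' (fcoef c a j') (cfun c p) =
    partial i' (fun x => f x * fcoef c b j' x) (cfun c p).
  by apply: near_eq_partial; apply: filterS E => x; exact.
rewrite !mxE !pE !partialM // !big_ord1 !mxE; ring.
Qed.

End ExteriorDerivative.

(** * Vector fields supported in a chart *)

Section BumpField.
Local Open Scope classical_set_scope.
Local Open Scope ring_scope.
Context {R : realType} {d : nat} {M : smooth_manifold R d}.

(** The function b is flat 0 of r^2 - |x - x0|^2 in the coordinates of c.  It
vanishes outside a box whose preimage K is compact, hence closed in the
Hausdorff space M: the complement of K is an open set on which the field is 0,
and together with the domain of c it covers M. *)
Lemma bump_vfield (c : chart R d M) (p : M) (w : 'rV[R]_d) : atlas c -> cdom c p ->
  exists b : M -> R, [/\ 0 < b p, (forall q, ~ cdom c q -> b q = 0) &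
    smooth_vfield (fun q => b q *: tvec c q w)].
Proof.
move=> ac cp; set x0 := cfun c p.
have nx0 : nbhs x0 (cfun c @` cdom c).
  by apply: open_nbhs_nbhs; split; [exact: cimg_open|exists p].
have [e /= e0 ball_e] := (nbhs_ballP _ _).1 nx0.
pose r := e / 2; have r0 : 0 < r by rewrite divr_gt0.
pose box := [set x : 'rV[R]_d | forall i, `[x0 0 i - r, x0 0 i + r]%classic (x 0 i)].
have box_sub : box `<=` cfun c @` cdom c.
  move=> x bx; apply: ball_e; split => // i j; rewrite ord1 /ball /=.
  have := bx j; rewrite /= in_itv /= => /andP[? ?].
  rewrite ltr_norml; have : r < e by rewrite ltr_pdivrMr // ltr_pMr // ltr1n.
  by move=> re; apply/andP; split; lra.
pose K := cinv c @` box.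
have Kclosed : closed K.
  apply: compact_closed; first exact: carrier_hausdorff.
  apply: continuous_compact.
    exact: continuous_subspaceW box_sub (@cinv_continuous _ _ _ c).
  apply: (@rV_compact _ _ (fun i => `[x0 0 i - r, x0 0 i + r]%classic)) => i.
  exact: segment_compact.
pose l (x : 'rV[R]_d) := r ^+ 2 - \sum_i (x 0 i - x0 0 i) * (x 0 i - x0 0 i).
pose b q := if `[< cdom c q >] then flat 0 (l (cfun c q)) else 0.
have b_in q : cdom c q -> b q = flat 0 (l (cfun c q)) by move=> cq; rewrite /b asboolT.
have b_out q : ~ K q -> b q = 0.
  move=> nKq; rewrite /b; case: asboolP => // cq.
  rewrite /flat ifF //; apply/negbTE; rewrite -leNgt subr_le0 leNgt.
  apply/negP => lr; apply: nKq; exists (cfun c q); last exact: cfunKp.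
  move=> i; have : (cfun c q 0 i - x0 0 i) ^+ 2 <= r ^+ 2.
    apply: le_trans (ltW lr); rewrite (bigD1 i) //= -expr2 lerDl sumr_ge0 // => j _.
    by rewrite -expr2 sqr_ge0.
  rewrite -[leLHS]real_normK ?num_real // ler_sqr ?nnegrE ?(ltW r0) //
    ler_norml => /andP[h1 h2].
  by rewrite /= in_itv /=; apply/andP; split; lra.
exists b; split.
- rewrite b_in // flat_gt0 // subr_gt0 big1 ?exprn_gt0 // => i _.
  by rewrite subrr mul0r.
- by move=> q ncq; rewrite /b asboolF.
- apply: smooth_vfield_local => q; have [cq|ncq] := pselect (cdom c q).
    exists c, (cdom c); split => //; first exact: cdom_open.
    rewrite setIid => j; have Wo := @cimg_open _ _ _ c.
    apply: (smooth_eq Wo (f := fun x => flat 0 (l x) * w 0 j)).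
      move=> x; rewrite inE => -[s cs <-]; rewrite /vcoef cfunKp //.
      by rewrite tcoordE // -scalemxAl -tcoordE // tvecK // b_in // mxE.
    apply: smoothM => //; last exact: smooth_cst.
    apply: smooth_flat => //; apply: smoothB => //; first exact: smooth_cst.
    apply: smooth_sum => // i _.
    by apply: smoothM => //; apply: smoothB => //;
      by [exact: smooth_coord|exact: smooth_cst].
  exists (chart_at q), (~` K); split.
  - exact: chart_at_atlas.
  - exact: closed_openC.
  - exact: chart_at_dom.
  - move=> [x bx xq]; apply: ncq; rewrite -xq; have [s cs <-] := box_sub x bx.
    by rewrite cfunKp.
  - move=> j; have Wo := image_of_open (c := chart_at q) (closed_openC Kclosed).
    apply: (smooth_eq Wo (f := fun=> 0)); last exact: smooth_cst.
    move=> x; rewrite inE => -[s [cs nKs] <-]; rewrite /vcoef cfunKp // b_out //.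
    by rewrite scale0r tcoordE ?mul0mx ?mxE //; exact: chart_at_atlas.
Qed.

End BumpField.

(** * Linear algebra of a contact form at a point *)

Section ContactAlgebra.
Local Open Scope ring_scope.
Context {R : realType} {d : nat}.
Variables (A : 'M[R]_d) (l : 'rV[R]_d).
Hypothesis A_anti : A^T = - A.
Implicit Types x y v w : 'rV[R]_d.

Let form x := (x *m l^T) 0 0.
Let bil x y := (x *m A *m y^T) 0 0.

Hypothesis nondegenerate : forall x,
  form x = 0 -> (forall y, form y = 0 -> bil x y = 0) -> x = 0.

Lemma mx11_eq0 (C : 'M[R]_1) : C 0 0 = 0 -> C = 0.
Proof. by move=> C0; apply/matrixP => i j; rewrite !ord1 mxE. Qed.

Lemma bil_anti x y : bil y x = - bil x y.
Proof.
rewrite /bil -[y *m A *m x^T]trmxK mxE !trmx_mul !trmxK A_anti.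
by rewrite mulNmx mulmxN mulmxA mxE.
Qed.

Lemma bilDl a x y z : bil (a *: x + y) z = a * bil x z + bil y z.
Proof. by rewrite /bil !mulmxDl -!scalemxAl mxE [X in X + _]mxE. Qed.

Lemma formDl a x y : form (a *: x + y) = a * form x + form y.
Proof. by rewrite /form mulmxDl -scalemxAl mxE [X in X + _]mxE. Qed.

Lemma eq_oppr0 (r : R) : r = - r -> r = 0.
Proof. lra. Qed.

Lemma bil_diag x : bil x x = 0.
Proof. by apply: eq_oppr0; rewrite -bil_anti. Qed.

Lemma kernel_eq0 x : form x = 0 -> x *m A = 0 -> x = 0.
Proof. by move=> lx xA; apply: nondegenerate => // y _; rewrite /bil xA mul0mx mxE. Qed.

(** An antisymmetric matrix of odd size is singular, and nondegeneracy on ker l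
keeps a kernel vector out of ker l, so that it can be normalized. *)
Lemma reeb_vector_exists : odd d -> exists v, v *m A = 0 /\ form v = 1.
Proof.
move=> od.
have /det0P [v v0 vA] : \det A == 0.
  apply/eqP; apply: eq_oppr0.
  by rewrite -{1}det_tr A_anti -scaleN1r detZ -signr_odd od expr1 mulN1r.
have lv : form v != 0.
  by apply: contra v0 => /eqP lv; apply/eqP; exact: kernel_eq0.
exists ((form v)^-1 *: v); rewrite -scalemxAl vA scaler0; split => //.
by rewrite -[_ *: v]addr0 formDl mulVf // /form mul0mx mxE addr0.
Qed.

Variable v : 'rV[R]_d.
Hypotheses (vA : v *m A = 0) (lv : form v = 1).

(** The kernel of A meets ker l trivially and l is onto R, so that the kernel of
A is the line through v. *)
Lemma kernel_line x : x *m A = 0 -> x = form x *: v.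
Proof.
move=> xA; apply/eqP; rewrite -subr_eq0 addrC -scaleNr; apply/eqP/kernel_eq0.
  by rewrite formDl lv mulr1 addNr.
by rewrite mulmxDl -scalemxAl vA xA scaler0 addr0.
Qed.

(** Adding l^T l turns the overdetermined system v A = 0, l v = 1 into the square
one v B = l with B invertible: Cramer's rule then expresses v by smooth
functions of the coefficients of A and l. *)
Lemma reeb_vectorP :
  A + l^T *m l \in unitmx /\ v = l *m invmx (A + l^T *m l).
Proof.
set B := A + l^T *m l.
have lvE : v *m l^T = 1%:M.
  by apply/matrixP => i j; rewrite !ord1 [LHS]lv mxE.
have vB : v *m B = l by rewrite /B mulmxDr vA add0r mulmxA lvE mul1mx.
(* v B = l determines v once B is known to be invertible. *)
suff Bu : B \in unitmx by split => //; rewrite -{1}vB -mulmxA mulmxV ?mulmx1.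
rewrite unitmxE unitfE; apply/negP => /det0P [x x0 xB].
case/negP: x0; apply/eqP.
have Av : A *m v^T = 0.
  by rewrite -[A *m v^T]trmxK trmx_mul trmxK A_anti mulmxN vA oppr0 trmx0.
have lvT : l *m v^T = 1%:M by rewrite -[l *m v^T]trmxK trmx_mul trmxK lvE trmx1.
have lx : x *m l^T = 0.
  have := congr1 (mulmx^~ v^T) xB.
  by rewrite mul0mx /B mulmxDr mulmxDl -!mulmxA Av lvT mulmx0 add0r mulmx1.
apply: kernel_eq0; first by rewrite /form lx mxE.
by move: xB; rewrite /B mulmxDr mulmxA lx mul0mx addr0.
Qed.

Variable n : nat.
Hypotheses (nd : (n <= d)%N) (dn : (d < n + n)%N).
Let T x := forall j : 'I_d, (n <= j)%N -> x 0 j = 0.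

Lemma slice_rowP x : T x <-> exists y : 'rV[R]_n, x = y *m pid_mx n.
Proof.
split=> [Tx|[y ->] j nj]; last first.
  rewrite mxE big1 // => i _; rewrite mxE.
  case: eqP => [ij|_]; last by rewrite mulr0.
  by move: (ltn_ord i); rewrite ij ltnNge nj.
exists (\row_i x 0 (widen_ord nd i)); apply/rowP => j; rewrite mxE.
have [jn|nj] := ltnP j n.
  rewrite (bigD1 (Ordinal jn)) //= big1 ?addr0 => [|i ij].
    by rewrite !mxE eqxx jn mulr1; congr (x 0 _); exact: val_inj.
  rewrite !mxE; case: eqP => [E|_]; last by rewrite mulr0.
  by case/negP: ij; apply/eqP/val_inj.
rewrite Tx // big1 // => i _; rewrite !mxE.
case: eqP => [E|_]; last by rewrite mulr0.
by move: (ltn_ord i); rewrite E ltnNge nj.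
Qed.

(** If v is not in T, the kernel of A meets T trivially, so that A is injective
on T and T A has dimension n.  Isotropy puts T A in the annihilator of T, of
dimension d - n < n. *)
Lemma isotropic_reeb : (forall x y, T x -> T y -> bil x y = 0) -> T v.
Proof.
move=> iso; pose N : 'M[R]_(n, d) := pid_mx n.
have [//|nTv] := pselect (T v); exfalso.
have rN : \rank N = n by rewrite rank_pid_mx.
have NAN : N *m A *m N^T = 0.
  apply/matrixP => i j.
  have TN k : T (row k N).
    by apply/slice_rowP; exists (delta_mx 0 k); rewrite -rowE.
  rewrite [RHS]mxE -(iso _ _ (TN i) (TN j)) /bil [LHS]mxE [RHS]mxE.
  by apply: eq_bigr => k _; rewrite -row_mul !mxE.
have rNA : row_free (N *m A).
  rewrite -kermx_eq0; apply/rowV0P => y /sub_kermxP; rewrite mulmxA => yNA.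
  have yN := kernel_line yNA.
  move: (form _) yN => c yN.
  have [f0|f0] := eqVneq c 0.
    move: yN; rewrite f0 scale0r => yN.
    have /row_freeP [N' NN'] : row_free N by rewrite /row_free rN.
    by rewrite -[y]mulmx1 -NN' mulmxA yN mul0mx.
  case: nTv; apply/slice_rowP; exists (c^-1 *: y).
  by rewrite -scalemxAl yN scalerA mulVf // scale1r.
have := mulmx0_rank_max NAN.
by rewrite mxrank_tr rN (eqP rNA) leqNgt dn.
Qed.

(** Both arguments can be reduced modulo ker l to multiples of t, and the bilinear
form vanishes on (t, t) by antisymmetry. *)
Lemma isotropic_of_kernel_isotropic t : T t -> form t = 1 ->
  (forall x y, T x -> T y -> form x = 0 -> bil x y = 0) ->
  forall x y, T x -> T y -> bil x y = 0.
Proof.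
move=> Tt lt ker x y Tx Ty.
have TD a z z' : T z -> T z' -> T (a *: z + z').
  by move=> Tz Tz' j nj; rewrite !mxE Tz // Tz' // mulr0 addr0.
have split z : z = form z *: t + ((- form z) *: t + z).
  by rewrite addrA -scalerDl subrr scale0r add0r.
have split_bil z w : T z -> T w -> bil z w = form z * bil t w.
  move=> Tz Tw; have Tz' : T (- form z *: t + z) by exact: TD.
  have fz' : form (- form z *: t + z) = 0 by rewrite formDl lt mulr1 addNr.
  by rewrite {1}[z]split bilDl (ker _ _ Tz' Tw fz') addr0.
by rewrite split_bil // bil_anti split_bil // bil_diag mulr0 oppr0 mulr0.
Qed.

End ContactAlgebra.

(** * The Reeb vector field *)

Section Reeb.
Local Open Scope classical_set_scope.
Local Open Scope ring_scope.
Context {R : realType} {d : nat} {M : smooth_manifold R d}.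
Variable lambda : one_form M.
Hypothesis lambda_contact : contact_form setT lambda.

Let slam : smooth_1form setT lambda. Proof. by case: lambda_contact. Qed.
Let llam p : linear_on setT (lambda p). Proof. by have [+ _] := slam; exact. Qed.

(** The contact condition is imposed at p in its preferred chart; this is the same
condition read off in an arbitrary chart of the atlas. *)
Lemma contact_nondegenerate c p : atlas c -> cdom c p -> forall x : 'rV[R]_d,
  (x *m (frow c lambda p)^T) 0 0 = 0 ->
  (forall y : 'rV[R]_d, (y *m (frow c lambda p)^T) 0 0 = 0 ->
    (x *m dmat c lambda p *m y^T) 0 0 = 0) -> x = 0.
Proof.
move=> ac cp x lx xy; have [_ /(_ p I) [_ nd]] := lambda_contact.
rewrite -(tvecK x ac cp) (nd (tvec c p x)) ?tcoordE ?mul0mx //.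
  by rewrite /form_ker /= (formE _ (llam p) ac cp) tvecK.
move=> w lw; rewrite (ext_deriv_chart _ _ slam openT I ac cp) tvecK //.
by apply: xy; rewrite -formE.
Qed.

Lemma reeb_in_chart v c p : atlas c -> cdom c p ->
  (forall w, ext_deriv lambda p v w = 0) -> lambda p v = 1 ->
  tcoord c p v *m dmat c lambda p = 0 /\
  (tcoord c p v *m (frow c lambda p)^T) 0 0 = 1.
Proof.
move=> ac cp dv lv; rewrite -formE //; split => //.
apply/rowP => j; rewrite [RHS]mxE -(dv (tvec c p (delta_mx 0 j))).
by rewrite (ext_deriv_chart _ _ slam openT I ac cp) tvecK // trmx_delta -colE [RHS]mxE.
Qed.

(** Pointwise existence is linear algebra in the preferred charts.  In any chart
the components solve the invertible system of reeb_vectorP, which makes the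
chosen vectors depend smoothly on the point. *)
Lemma reeb_exists : odd d -> exists v : vfield M, is_reeb lambda v.
Proof.
move=> od.
have /choice [v vP] : forall p : M, exists v : 'rV[R]_d,
    (forall w, ext_deriv lambda p v w = 0) /\ lambda p v = 1.
  move=> p; have ap := @chart_at_atlas _ _ M p; have cp := @chart_at_dom _ _ M p.
  have [v [vA lv]] := reeb_vector_exists (dmat_anti _ _ _)
    (contact_nondegenerate ap cp) od.
  exists v; split => [w|]; first by rewrite ext_derivE vA mul0mx mxE.
  by rewrite (formE _ (llam p) ap cp) tcoord_chart_at.
exists v; split => // c ac i.
have Wo := @cimg_open _ _ _ c.
pose B x := dmat c lambda (cinv c x) +
  (frow c lambda (cinv c x))^T *m frow c lambda (cinv c x).
have sl j : smooth_on (cfun c @` cdom c) (fun x => frow c lambda (cinv c x) 0 j).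
  by rewrite -image_ofT; exact: (smooth_frow _ slam openT ac).
have sB j k : smooth_on (cfun c @` cdom c) (fun x => B x j k).
  apply: (smooth_eq Wo (f := fun x => dmat c lambda (cinv c x) j k +
     frow c lambda (cinv c x) 0 j * frow c lambda (cinv c x) 0 k)).
    by move=> x _; rewrite [RHS]mxE; congr (_ + _); rewrite [RHS]mxE big_ord1 !mxE.
  apply: smoothD => //; last exact: smoothM.
  by rewrite -image_ofT; exact: (smooth_dmat _ _ slam openT ac).
have vB x : (cfun c @` cdom c) x -> B x \in unitmx /\
    tcoord c (cinv c x) (v (cinv c x)) = frow c lambda (cinv c x) *m invmx (B x).
  move=> [p cp <-]; have cp' : cdom c (cinv c (cfun c p)) by rewrite cfunKp.
  have [dv lv] := vP (cinv c (cfun c p)).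
  have [vA lvc] := reeb_in_chart ac cp' dv lv.
  exact: (reeb_vectorP (dmat_anti _ _ _) (contact_nondegenerate ac cp')).
apply: (smooth_eq Wo (f := fun x =>
   \sum_j frow c lambda (cinv c x) 0 j * ((\det (B x))^-1 * (\adj (B x)) j i))).
  move=> x; rewrite inE => /vB [Bu E]; rewrite /vcoef E mxE.
  by apply: eq_bigr => j _; rewrite /invmx Bu !mxE.
apply: smooth_sum => // j _; apply: smoothM => //; apply: smoothM => //.
  apply: smoothV => // [x /vB [Bu _]|]; last exact: smooth_det.
  by rewrite -unitfE -unitmxE.
exact: smooth_adj.
Qed.

End Reeb.

(** * Tangent spaces and Lie derivatives along a foliation *)

Section Foliations.
Local Open Scope classical_set_scope.
Local Open Scope ring_scope.
Context {R : realType} {d : nat} {M : smooth_manifold R d}.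
Implicit Types (c : chart R d M) (p : M) (a : one_form M).

Lemma line_near k (x v : 'rV[R]_k) (W : set 'rV[R]_k) :
  nbhs x W -> \forall t \near (0 : R), W (x + t *: v).
Proof.
move=> xW; have cont : {for (0 : R), continuous (fun t : R => x + t *: v)}.
  by apply: cvgD; [exact: cvg_cst|exact: scalel_continuous].
by apply: cont; rewrite scale0r addr0.
Qed.

Lemma derive_line k (f : 'rV[R]_k -> R) x v :
  'D_v f x = 'D_1 (fun t : R => f (x + t *: v)) 0.
Proof.
have E : (fun h : R => h^-1 *: ((f \o shift x) (h *: v) - f x)) =
    (fun h : R => h^-1 *: (((fun t : R => f (x + t *: v)) \o shift 0) (h *: 1)
                          - f (x + 0 *: v))).
  apply/funext => h /=.
  by rewrite addr0 scale0r addr0 [x + _]addrC [h *: 1]mulr1.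
by rewrite /derive E.
Qed.

Lemma derive_line_cst k (f : 'rV[R]_k -> R) x v (r : R) :
  (\forall t \near (0 : R), f (x + t *: v) = r) -> 'D_v f x = 0.
Proof.
by move=> fr; rewrite derive_line (near_eq_derive _ fr) derive_cst.
Qed.

Lemma same_slice_line n (x : 'rV[R]_d) (i : 'I_d) (t : R) : (i < n)%N ->
  same_slice n (x + t *: delta_mx 0 i) x.
Proof.
move=> it j nj; rewrite !mxE eqxx /= (_ : (j == i) = false) ?mulr0 ?addr0 //.
by apply/eqP => ji; move: it; rewrite -ji ltnNge nj.
Qed.

Section OneFoliation.
Variables (n : nat) (F : foliation M n).

Lemma fatlas_atlas c : fatlas F c -> atlas c.
Proof. exact: fatlas_sub. Qed.

(** The transverse coordinates of c' are constant along the slices of c. *)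
Lemma jac_slice c c' p (i l : 'I_d) : fatlas F c -> fatlas F c' ->
  cdom c p -> cdom c' p -> (i < n)%N -> (n <= l)%N -> jac c c' p i l = 0.
Proof.
move=> fc fc' cp cp' it nl; rewrite mxE /partial.
have [W xW slW] := fatlas_slice fc fc' (image_of_mem cp cp').
apply: (@derive_line_cst _ _ _ _ (cfun c' (cinv c (cfun c p)) 0 l)).
apply: filterS (line_near (delta_mx 0 i) xW) => t Wt.
by apply: slW => //; [exact: nbhs_singleton xW|exact: same_slice_line].
Qed.

(** One adapted chart decides tangency, because differentials of transitions
between adapted charts preserve the directions of the slices (jac_slice). *)
Lemma tangentP c p v : fatlas F c -> cdom c p ->
  tangent F p v <-> forall j : 'I_d, (n <= j)%N -> tcoord c p v 0 j = 0.
Proof.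
move=> fc cp; split => [tv j nj|tv c' fc' cp' j nj].
  by rewrite (tv _ fc cp) // mxE.
rewrite (tcoord_change _ (fatlas_atlas fc) (fatlas_atlas fc')) // !mxE big1 // => i _.
have [it|ni] := ltnP i n; first by rewrite (jac_slice fc) ?mulr0.
by rewrite tv // mul0r.
Qed.

Lemma tangent_linear p (b : R) v w :
  tangent F p v -> tangent F p w -> tangent F p (b *: v + w).
Proof.
have [c fc cp] := fatlas_cover F p; have ac := fatlas_atlas fc.
move=> /(tangentP _ fc cp) tv /(tangentP _ fc cp) tw; apply/(tangentP _ fc cp) => j nj.
rewrite tcoordE // mulmxDl -scalemxAl -!tcoordE //.
by rewrite !mxE tv // tw // mulr0 addr0.
Qed.

Lemma tangent_tvec c p (x : 'rV[R]_d) : fatlas F c -> cdom c p ->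
  (forall j : 'I_d, (n <= j)%N -> x 0 j = 0) -> tangent F p (tvec c p x).
Proof.
move=> fc cp x0; apply/(tangentP _ fc cp) => j nj.
by rewrite tvecK //; [exact: x0|exact: fatlas_atlas].
Qed.

Lemma delta_slice (i : 'I_d) : (i < n)%N ->
  forall j : 'I_d, (n <= j)%N -> (delta_mx 0 i : 'rV[R]_d) 0 j = 0.
Proof.
move=> it j nj; rewrite mxE eqxx /= (_ : (j == i) = false) //.
by apply/eqP => ji; move: it; rewrite -ji ltnNge nj.
Qed.

Lemma tangent0 p : tangent F p 0.
Proof.
have [c fc cp] := fatlas_cover F p; apply/(tangentP _ fc cp) => j _.
by rewrite tcoordE ?mul0mx ?mxE //; exact: fatlas_atlas.
Qed.

Lemma tangentZ p (b : R) v : tangent F p v -> tangent F p (b *: v).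
Proof. by move=> tv; have := tangent_linear b tv (@tangent0 p); rewrite addr0. Qed.

(** In an adapted chart the coefficients of a along the slices vanish on an open
set, and d a on tangent vectors only involves the partials of these
coefficients. *)
Lemma isotropic_of_integral (U : set M) a : smooth_1form U a -> open U ->
  (forall q, U q -> forall v, tangent F q v -> a q v = 0) ->
  forall p u w, U p -> tangent F p u -> tangent F p w -> ext_deriv a p u w = 0.
Proof.
move=> sa Uo a0 p u w Up tu tw.
have [c fc cp] := fatlas_cover F p; have ac := fatlas_atlas fc.
rewrite (ext_deriv_chart _ _ sa Uo Up ac cp).
have {}tu := (tangentP _ fc cp).1 tu; have {}tw := (tangentP _ fc cp).1 tw.
have Wo := image_of_open (c := c) Uo.
have Wp : image_of c U (cfun c p) by exists p.
have coef0 (j : 'I_d) : (j < n)%N -> {in image_of c U, (fun=> 0) =1 fcoef c a j}.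
  move=> jn x; rewrite inE => -[q [cq Uq] <-]; rewrite /fcoef cfunKp // a0 //.
  exact: tangent_tvec (delta_slice jn).
have pcoef0 (i j : 'I_d) : (j < n)%N -> partial i (fcoef c a j) (cfun c p) = 0.
  move=> jn; rewrite -(near_eq_partial _ (eq_on_near Wo (coef0 j jn) Wp)).
  exact: partial_cst.
rewrite mxE big1 // => j _; have [jn|nj] := ltnP j n; last by rewrite [_^T _ _]mxE tw // mulr0.
rewrite mxE big1 ?mul0r // => i _; have [it|ni] := ltnP i n; last by rewrite tu // mul0r.
by rewrite mxE !pcoef0 // subr0 mulr0.
Qed.

Lemma slice_pt_leaf (x : 'rV[R]_d) (z : 'rV[R]_n) (j : 'I_d) (jn : (j < n)%N) :
  slice_pt x z 0 j = z 0 (Ordinal jn).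
Proof. by rewrite mxE (insubT (fun m => m < n)%N jn). Qed.

Lemma slice_pt_transverse (x : 'rV[R]_d) (z : 'rV[R]_n) (j : 'I_d) : (n <= j)%N ->
  slice_pt x z 0 j = x 0 j.
Proof. by move=> nj; rewrite mxE insubF // ltnNge nj. Qed.

Lemma smooth_slice_pt (x : 'rV[R]_d) : smooth_map setT (@slice_pt R d n x).
Proof.
move=> j; have [jn|nj] := ltnP j n.
  apply: (smooth_eq openT (f := fun z : 'rV[R]_n => z 0 (Ordinal jn))).
    by move=> z _; rewrite slice_pt_leaf.
  exact: (smooth_coord openT).
apply: (smooth_eq openT (f := fun=> x 0 j)); last exact: (smooth_cst openT).
by move=> z _; rewrite slice_pt_transverse.
Qed.

Lemma smooth_leaf_vfield (L : set M) (X : vfield M) : smooth_vfield X ->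
  (forall p, L p -> tangent F p (X p)) -> leaf_vfield F L X.
Proof.
move=> sX tX; split => // c fc p cp Lp i.
apply: smooth_comp (sX c (fatlas_atlas fc) i) => //.
- apply: open_comp (@cimg_open _ _ _ c) => z _.
  exact/differentiable_continuous/smooth_map_diff/(I : setT z)/smooth_slice_pt.
- by move=> j; apply: smooth_sub (smooth_slice_pt (cfun c p) j).
Qed.

(** A field on a leaf is smooth in the coordinates of the plaque only; the
derivative along a leaf direction is computed inside the plaque, so that it
exists also as a directional derivative in R^d. *)
Lemma leaf_vfield_derivable (L : set M) (u : vfield M) c p (i j : 'I_d) :
  (n <= d)%N -> leaf_vfield F L u -> fatlas F c -> cdom c p -> L p -> (i < n)%N ->
  derivable (vcoef c u j) (cfun c p) (delta_mx 0 i).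
Proof.
move=> nd [_ su] fc cp Lp it; set x := cfun c p.
pose z0 : 'rV[R]_n := \row_k x 0 (widen_ord nd k).
have slE t : slice_pt x (t *: delta_mx 0 (Ordinal it) + z0) = t *: delta_mx 0 i + x.
  apply/rowP => k; have [kn|nk] := ltnP k n.
    by rewrite slice_pt_leaf !mxE; congr (_ * _ + x 0 _); exact: val_inj.
  rewrite slice_pt_transverse // [RHS]mxE -[LHS]add0r; congr (_ + _).
  by rewrite mxE delta_slice // mulr0.
have z0E : slice_pt x z0 = x by have := slE 0; rewrite !scale0r !add0r.
have /diff_derivable dg : differentiable (fun z => vcoef c u j (slice_pt x z)) z0.
  by apply: smooth_diff (su c fc p cp Lp j) _; rewrite /= z0E; exists p.
have := dg (delta_mx 0 (Ordinal it)); rewrite /derivable.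
have -> // : (fun h : R => h^-1 *: (((fun z => vcoef c u j (slice_pt x z)) \o shift z0)
    (h *: delta_mx 0 (Ordinal it)) - vcoef c u j (slice_pt x z0))) =
  (fun h : R => h^-1 *: ((vcoef c u j \o shift x) (h *: delta_mx 0 i) - vcoef c u j x)).
by apply/funext => h /=; rewrite slE z0E.
Qed.

Lemma leaf_plaque (L : set M) c p (x : 'rV[R]_d) : is_leaf F L -> fatlas F c ->
  cdom c p -> L p -> (cfun c @` cdom c) x -> same_slice n (cfun c p) x -> L (cinv c x).
Proof.
move=> [q0 ->] fc cp /= Lp [q cq <-] sl; rewrite cfunKp //.
exact: same_leaf_plaque Lp fc cp cq sl.
Qed.

(** Cartan's formula along a leaf: L_u a is i_u d a plus the leafwise derivative
of a u, which is 0 on the leaf. *)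
Lemma leaf_lie_derivE (L : set M) (u : vfield M) a c p (i : 'I_d) :
  (n <= d)%N -> smooth_1form setT a -> is_leaf F L -> leaf_vfield F L u ->
  (forall q, L q -> a q (u q) = 0) ->
  fatlas F c -> cdom c p -> L p -> (i < n)%N ->
  leaf_lie_deriv n u a c p i = ext_deriv a p (u p) (tvec c p (delta_mx 0 i)).
Proof.
move=> nd sa leafL lu au fc cp Lp it; have ac := fatlas_atlas fc.
have [la sca] := sa.
have [tu _] := lu; set x := cfun c p.
have cx : (cfun c @` cdom c) x by exists p.
have da j : differentiable (fcoef c a j) x.
  by apply: smooth_diff (sca c ac j) _; rewrite setIT.
have du j : derivable (vcoef c u j) x (delta_mx 0 i).
  exact: leaf_vfield_derivable lu fc cp Lp it.
pose h (y : 'rV[R]_d) := \sum_(j < d | (j < n)%N) fcoef c a j y * vcoef c u j y.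
have hE : 'D_(delta_mx 0 i) h x = 0.
  apply: (@derive_line_cst _ _ _ _ 0).
  apply: filterS (line_near (delta_mx 0 i) (open_nbhs_nbhs (conj (@cimg_open _ _ _ c) cx))).
  move=> t; set y := x + _ => cy.
  have Ly : L (cinv c y).
    apply: leaf_plaque leafL fc cp Lp cy _ => k nk.
    by rewrite (same_slice_line _ _ it).
  have cqy : cdom c (cinv c y) by case: cy => q cq <-; rewrite cfunKp.
  have yE : cfun c (cinv c y) = y by case: cy => q cq <-; rewrite cfunKp.
  rewrite /h; apply: etrans (au _ Ly); rewrite (form_tcoord (la _ I) ac cqy) yE
    [RHS](bigID (fun j : 'I_d => (j < n)%N)) /=.
  rewrite [X in _ = _ + X]big1 ?addr0 => [|j].
    by apply: eq_bigr => j _; rewrite mulrC.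
  rewrite -leqNgt => nj; have /(tangentP _ fc cqy) -> // := tu _ Ly.
  by rewrite mul0r.
have hE' : 'D_(delta_mx 0 i) h x = \sum_(j < d | (j < n)%N)
    (fcoef c a j x * partial i (vcoef c u j) x + vcoef c u j x * partial i (fcoef c a j) x).
  pose k (j : 'I_d) := if (j < n)%N then fcoef c a j * vcoef c u j else cst 0.
  have -> : h = \sum_(j < d) k j.
    apply/funext => y; rewrite /h fct_sumE big_mkcond; apply: eq_bigr => j _ /=.
    by rewrite /k; case: ifP.
  rewrite derive_sum => [|j]; last first.
    rewrite /k; case: ifP => _; last exact: derivable_cst.
    by apply: derivableM => //; exact: diff_derivable.
  rewrite [RHS]big_mkcond; apply: eq_bigr => j _; rewrite /k.
  case: ifP => jn; last exact: derive_cst.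
  by rewrite deriveM //; exact: diff_derivable.
rewrite (ext_deriv_chart _ _ sa openT I ac cp) tvecK // trmx_delta -colE mxE mxE.
have {}hE := etrans (esym hE') hE; rewrite big_split /= in hE.
rewrite /leaf_lie_deriv big_split /= -/x.
rewrite [X in _ + X](_ : _ = - \sum_(j < d | (j < n)%N) vcoef c u j x *
  partial i (fcoef c a j) x); last first.
  by apply/eqP; rewrite -addr_eq0 hE.
rewrite -sumrB [RHS](bigID (fun j : 'I_d => (j < n)%N)) /= [X in _ = _ + X]big1 ?addr0.
  apply: eq_bigr => j _; rewrite [X in _ = _ * X]mxE mulrBr.
  by rewrite /vcoef cfunKp.
move=> j; rewrite -leqNgt => nj; have /(tangentP _ fc cp) -> // := tu _ Lp.
by rewrite mul0r.
Qed.

End OneFoliation.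
End Foliations.

(** * Contact forms with a given restriction to the leaves *)

Section Extension.
Local Open Scope classical_set_scope.
Local Open Scope ring_scope.
Context {R : realType} {d : nat} {M : smooth_manifold R d}.
Implicit Types (c : chart R d M) (p : M) (a : one_form M).

Lemma linear_form_proportional (f g : 'rV[R]_d -> R) e :
  linear_on setT f -> linear_on setT g -> g e <> 0 ->
  (forall w, g w = 0 -> f w = 0) -> forall w, f w = f e / g e * g w.
Proof.
move=> lf lg /eqP ge fg w.
have := fg (- (g w / g e) *: e + w); rewrite lg // lf //.
rewrite mulNr divfK // addNr => /(_ erefl) /eqP; rewrite addrC mulNr subr_eq0 => /eqP ->.
by ring.
Qed.

Lemma chart_preimage_open c (W : set 'rV[R]_d) : open W ->
  open [set q | cdom c q /\ W (cfun c q)].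
Proof.
move=> Wo; rewrite openE => q [cq Wq]; rewrite /interior.
have n1 := open_nbhs_nbhs (conj (@cdom_open _ _ _ c) cq).
have n2 : nbhs q (cfun c @^-1` W).
  by apply: (cfun_continuousP cq); exact: open_nbhs_nbhs.
by apply: filterS2 n1 n2 => r cr Wr; split.
Qed.

Lemma smooth_neq0_open k (U : set 'rV[R]_k) (f : 'rV[R]_k -> R) : open U ->
  smooth_on U f -> open [set x | U x /\ f x != 0].
Proof.
move=> Uo sf; rewrite openE => x [Ux fx]; rewrite /interior.
have n1 := open_nbhs_nbhs (conj Uo Ux).
have n2 : nbhs x (f @^-1` [set r | r != 0]).
  apply: (differentiable_continuous (smooth_diff sf Ux)).
  by apply: open_nbhs_nbhs; split => //; exact: open_neq.
by apply: filterS2 n1 n2 => y Uy fy; split.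
Qed.

Lemma form_coef_neq0 a c p v : linear_on setT (a p) -> atlas c -> cdom c p ->
  a p v <> 0 -> exists j, tcoord c p v 0 j != 0 /\ fcoef c a j (cfun c p) != 0.
Proof.
move=> la ac cp av; apply: contrapT => /forallNP noj; apply: av.
rewrite (form_tcoord la ac cp) big1 // => j _.
have [->|t0] := eqVneq (tcoord c p v 0 j) 0; first by rewrite mul0r.
have [->|f0] := eqVneq (fcoef c a j (cfun c p)) 0; first by rewrite mulr0.
by case: (noj j).
Qed.

(** Near p, lambda is f theta with f nowhere zero and theta a contact form of xi.
By dmat_scale d lambda is f d theta on ker theta, which is nondegenerate. *)
Lemma contact_of_kernel xi (lambda : one_form M) : contact_structure xi ->
  smooth_1form setT lambda -> (forall p, form_ker lambda p = xi p) ->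
  contact_form setT lambda.
Proof.
move=> xi_contact slam ker; split => // p _; have [llam clam] := slam.
have [U [theta [Uo Up [[lth cth] nth] thker]]] := xi_contact p.
have [[e the] nd] := nth p Up.
have kerE q : U q -> forall w, theta q w = 0 <-> lambda q w = 0.
  move=> Uq w; have := thker q Uq; rewrite -ker => E.
  by rewrite -[theta q w = 0]/(form_ker theta q w) -E.
have lame : lambda p e <> 0 by move=> /(kerE p Up).
split; first by exists e.
set c := chart_at p; have ac : atlas c := @chart_at_atlas _ _ M p.
have cp : cdom c p := @chart_at_dom _ _ M p.
have [j [_ thj]] := form_coef_neq0 (lth p Up) ac cp the.
set x := cfun c p; have Wx : image_of c U x by exists p.
have Wo := image_of_open (c := c) Uo.
have Vo := smooth_neq0_open Wo (cth c ac j).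
pose f y := fcoef c lambda j y / fcoef c theta j y.
have fE : {near x, forall y, forall k, fcoef c lambda k y = f y * fcoef c theta k y}.
  apply: filterS (open_near Vo (conj Wx thj)) => y [[q [cq Uq] <-] thjq] k.
  move: thjq; rewrite /f /fcoef cfunKp // => /eqP thjq.
  apply: (linear_form_proportional (llam q I) (lth q Uq) thjq).
  by move=> w /(kerE q Uq).
have dth k : differentiable (fcoef c theta k) x by exact: smooth_diff (cth c ac k) Wx.
have dlam k : differentiable (fcoef c lambda k) x.
  by apply: smooth_diff (clam c ac k) _; rewrite setIT; exists p.
have df : differentiable f x.
  by apply: differentiableM => //; exact: differentiableV.
have /= dE := dmat_scale fE df dth.
have fx : f x != 0.
  rewrite mulf_neq0 ?invr_eq0 //; apply/eqP => lamj0; apply: lame.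
  rewrite (form_tcoord (llam p I) ac cp) big1 // => k _.
  by rewrite (nbhs_singleton fE) /f lamj0 mul0r mul0r mulr0.
move=> v lv vnd; apply: nd; first exact/(kerE p Up).
move=> w thw; have /(kerE p Up) lw := thw.
have := vnd w lw; rewrite !ext_derivE -/c dE.
have kerm u : theta p u = 0 -> u *m (frow c theta p)^T = 0.
  move=> thu; apply: mx11_eq0; rewrite -[RHS]thu (formE _ (lth p Up) ac cp).
  by rewrite tcoord_chart_at.
have kv := kerm v ((kerE p Up v).2 lv); have kw := kerm w thw.
have kw' : frow c theta p *m w^T = 0.
  by rewrite -[_ *m _]trmxK trmx_mul trmxK kw trmx0.
rewrite mulmxBr mulmxDr mulmxBl mulmxDl -!mulmxA kw' !mulmx0 addr0.
rewrite [v *m ((frow c theta p)^T *m _)]mulmxA kv mul0mx subr0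
  -scalemxAl -scalemxAr mxE => /eqP.
by rewrite mulf_eq0 (negbTE fx) /= mulmxA => /eqP.
Qed.

Variables (n : nat) (F : foliation M n) (xi : plane_field M) (a : one_form M).
Hypothesis xi_contact : contact_structure xi.
Hypothesis sa : smooth_leafwise_form F a.
Hypothesis a_neq0 : forall p, exists2 v, tangent F p v & a p v <> 0.
Hypothesis a_ker : forall p, tangent F p `&` form_ker a p = tangent F p `&` xi p.

(** If theta has kernel xi, then a and theta have the same kernel on TF, so a is
proportional to theta there; the same multiple of theta is the extension. *)
Lemma extension_exists p : exists l : 'rV[R]_d -> R,
  [/\ linear_on setT l, [set v | l v = 0] = xi p & forall v, tangent F p v -> l v = a p v].
Proof.
have [U [theta [Uo Up [[lth _] _] thker]]] := xi_contact p.
have {}lth := lth p Up.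
have ker_tangent w : tangent F p w -> a p w = 0 <-> theta p w = 0.
  move=> tw; have := congr1 (fun S => S w) (a_ker p); rewrite thker //= => E.
  have {}E : (tangent F p w /\ a p w = 0) = (tangent F p w /\ theta p w = 0) by [].
  by split => h; [have [] : tangent F p w /\ theta p w = 0 by rewrite -E
                 |have [] : tangent F p w /\ a p w = 0 by rewrite E].
have [t tt ta] := a_neq0 p.
have tth : theta p t <> 0 by move=> /(ker_tangent t tt).
have tth' : theta p t != 0 by exact/eqP.
have c0 : a p t / theta p t != 0 by rewrite mulf_neq0 ?invr_eq0 //; exact/eqP.
exists (fun v => a p t / theta p t * theta p v); split.
- by move=> r v w _ _; rewrite lth //; ring.
- rewrite thker //; apply/seteqP; split => v /=.
    by move=> /eqP; rewrite mulf_eq0 (negbTE c0) => /eqP.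
  by move=> ->; rewrite mulr0.
- move=> v tv; have [la _] := sa.
  pose k := theta p v / theta p t.
  have tw : tangent F p (- k *: t + v) by exact: tangent_linear.
  have /(ker_tangent _ tw) : theta p (- k *: t + v) = 0.
    by rewrite lth // /k mulNr divfK // addNr.
  rewrite la // => /eqP; rewrite addrC mulNr subr_eq0 => /eqP ->.
  by rewrite /k mulrAC [RHS]mulrAC [a p t * _]mulrC.
Qed.

(** In an adapted chart there is a leaf direction i on which a, hence theta, does
not vanish, and lambda is theta multiplied by the quotient of the i-th
coefficients; the i-th coefficient of a is smooth as i is a leaf direction. *)
Lemma smooth_of_extension (lambda : one_form M) :
  (forall p, linear_on setT (lambda p)) -> (forall p, form_ker lambda p = xi p) ->
  (forall p v, tangent F p v -> lambda p v = a p v) -> smooth_1form setT lambda.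
Proof.
move=> llam ker ext; apply: smooth_1form_local => // p.
have [U [theta [Uo Up [[lth cth] nth] thker]]] := xi_contact p.
have kerE q : U q -> forall w, theta q w = 0 <-> lambda q w = 0.
  move=> Uq w; have := thker q Uq; rewrite -ker => E.
  by rewrite -[theta q w = 0]/(form_ker theta q w) -E.
have [c fc cp] := fatlas_cover F p; have ac := fatlas_atlas fc.
have [t tt at0] := a_neq0 p.
have lamt : lambda p t <> 0 by rewrite ext.
have [i [ti lami]] := form_coef_neq0 (llam p) ac cp lamt.
have it : (i < n)%N.
  by rewrite ltnNge; apply: contra ti => ni; apply/eqP; exact: (tangentP _ fc cp).1.
have thi : fcoef c theta i (cfun c p) != 0.
  apply/eqP; rewrite /fcoef cfunKp // => /(kerE p Up); apply/eqP.
  by move: lami; rewrite /fcoef cfunKp.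
have Wo := image_of_open (c := c) Uo.
have Vo := smooth_neq0_open Wo (cth c ac i).
set W := [set x | _ /\ _] in Vo.
have Wp : W (cfun c p) by split => //; exists p.
exists c, [set q | cdom c q /\ W (cfun c q)]; split => //.
  exact: chart_preimage_open.
move=> j; have So := image_of_open (c := c) (chart_preimage_open c Vo).
have sub q : W (cfun c q) -> cdom c q -> U q.
  by move=> [/image_ofP [_ +] _] cq; rewrite cfunKp.
apply: (smooth_eq So (f := fun x => fcoef c a i x / fcoef c theta i x * fcoef c theta j x)).
  move=> x; rewrite inE => -[q [cq [_ Wq]] <-].
  have Uq := sub q Wq cq; have [_ thq] := Wq.
  have -> : fcoef c a i (cfun c q) = fcoef c lambda i (cfun c q).
    rewrite /fcoef cfunKp // ext //; exact: tangent_tvec (delta_slice it).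
  move: thq; rewrite /fcoef cfunKp // => /eqP thq.
  apply/esym/(linear_form_proportional (llam q) (lth q Uq) thq).
  by move=> w /(kerE q Uq).
have sW x : image_of c [set q | cdom c q /\ W (cfun c q)] x -> image_of c U x.
  by move=> [q [cq [_ Wq]] <-]; exists q => //; split => //; exact: sub.
apply: smoothM => //; last exact: smooth_sub sW (cth c ac j).
apply: smoothM => //.
  have [_ /(_ c fc i it)] := sa; apply: smooth_sub => x [q [cq _] <-].
  by exists q.
apply: (smoothV So (f := fcoef c theta i)); last exact: smooth_sub sW (cth c ac i).
by move=> x [q [cq [_ [_ thq]]] <-]; exact: thq.
Qed.

End Extension.

(** * Invariant transverse measures and tangent Reeb fields *)

Section Equivalence.
Local Open Scope classical_set_scope.
Local Open Scope ring_scope.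
Context {R : realType} {d : nat} {M : smooth_manifold R d}.
Variables (n : nat) (F : foliation M n) (xi : plane_field M).
Hypotheses (nd : (n <= d)%N) (dn : (d < n + n)%N).
Variable k : nat.
Variable G : foliation M k.
Hypothesis tangentG : forall p, tangent G p = legendrian_distribution F xi p.

Lemma leaf_of p : exists L, is_leaf F L /\ L p.
Proof. by exists [set q | same_leaf F p q]; split; [exists p|exact: same_leaf_refl]. Qed.

Section FromReeb.
Variables (lambda : one_form M) (v : vfield M).
Hypothesis lambda_contact : contact_form setT lambda.
Hypothesis ker : forall p, form_ker lambda p = xi p.
Hypothesis v_reeb : is_reeb lambda v.
Hypothesis v_tangent : forall p, tangent F p (v p).

(** Subtracting a multiple of the Reeb vector, which is in the kernel of d lambda
and tangent to F, moves w into TG, where isotropic_of_integral applies. *)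
Lemma legendrian_ext_deriv0 p u w : tangent G p u -> tangent F p w ->
  ext_deriv lambda p u w = 0.
Proof.
move=> tu tw; have [slam _] := lambda_contact; have [llam _] := slam.
have [_ /(_ p) [dv lv]] := v_reeb.
pose r := lambda p w.
have tw' : tangent G p (- r *: v p + w).
  rewrite tangentG; split; first exact: tangent_linear.
  by rewrite -ker /form_ker /= llam // lv mulr1 addNr.
have G0 q : setT q -> forall z, tangent G q z -> lambda q z = 0.
  by move=> _ z; rewrite tangentG => -[_]; rewrite -ker.
have := isotropic_of_integral slam openT G0 I tu tw'.
rewrite !ext_derivE (bil_anti (dmat_anti _ _ _)) (bilDl _ (- r) (v p) w).
move: (dv u); rewrite ext_derivE => ->; rewrite mulr0 add0r.
by rewrite (bil_anti (dmat_anti _ _ _)) opprK.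
Qed.

Lemma invariant_measure_of_reeb : has_invariant_measure F xi.
Proof.
have [slam _] := lambda_contact; have [llam clam] := slam.
exists lambda.
  split=> [p r z w _ _|c fc i _]; first exact: llam.
  by rewrite -image_ofT; apply: clam; exact: fatlas_atlas fc.
move=> L leafL; split; [|split] => [p Lp|p Lp|u lu Du p Lp].
- exists (v p) => //; have [_ /(_ p) [_ ->]] := v_reeb.
  by apply/eqP; rewrite oner_eq0.
- by rewrite ker.
- have lu0 q : L q -> lambda q (u q) = 0.
    by move=> /Du [_]; rewrite -ker.
  split; first exact: lu0.
  move=> c fc cp i it.
  rewrite (leaf_lie_derivE nd slam leafL lu lu0 fc cp Lp it).
  apply: legendrian_ext_deriv0; first by rewrite tangentG; exact: Du.
  exact: tangent_tvec (delta_slice it).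
Qed.

End FromReeb.

Section FromMeasure.
Hypothesis xi_contact : contact_structure xi.
Variable a : one_form M.
Hypothesis sa : smooth_leafwise_form F a.
Hypothesis inv : forall L, is_leaf F L ->
  invariant_transverse_measure F (legendrian_distribution F xi) a L.

(** The conditions on the measures of the leaves are pointwise conditions on M,
since the leaves cover M. *)
Lemma measure_kernel p :
  (exists2 v, tangent F p v & a p v <> 0) /\
  tangent F p `&` form_ker a p = tangent F p `&` xi p.
Proof.
by have [L [leafL Lp]] := leaf_of p; have [h1 [h2 _]] := inv leafL;
  split; [exact: h1|exact: h2].
Qed.

Variable lambda : one_form M.
Hypothesis slam : smooth_1form setT lambda.
Hypothesis ext : forall p w, tangent F p w -> lambda p w = a p w.

(** Invariance speaks of fields on the whole leaf.  In a chart adapted to G the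
vector u extends to a field with constant coefficients, which bump_vfield cuts
off to a global field tangent to G with a positive multiple of u at p. *)
Lemma invariance_ext_deriv0 p u w : tangent G p u -> tangent F p w ->
  ext_deriv lambda p u w = 0.
Proof.
move=> tu tw; have [L [leafL Lp]] := leaf_of p.
have [_ [_ lie]] := inv leafL.
have [g fg gp] := fatlas_cover G p; have ag := fatlas_atlas fg.
have [b [b0 b_out sX]] := bump_vfield (tcoord g p u) ag gp.
set X := (fun q => _) in sX.
have XG q : tangent G q (X q).
  have [gq|ngq] := pselect (cdom g q); last by rewrite /X b_out // scale0r; exact: tangent0.
  apply: tangentZ; apply: (tangent_tvec fg gq); exact/(tangentP _ fg gp).
have XF q : tangent F q (X q) by have := XG q; rewrite tangentG => -[].
have lX : leaf_vfield F L X by apply: smooth_leaf_vfield.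
have DX q : L q -> legendrian_distribution F xi q (X q) by rewrite -tangentG.
have aX q : L q -> a q (X q) = 0 by move=> Lq; have [] := lie X lX DX q Lq.
have lamX q : L q -> lambda q (X q) = 0 by move=> Lq; rewrite ext // aX.
have [_ lieX] := lie X lX DX p Lp.
have [c fc cp] := fatlas_cover F p; have ac := fatlas_atlas fc.
have dX (i : 'I_d) : (i < n)%N -> ext_deriv lambda p (X p) (tvec c p (delta_mx 0 i)) = 0.
  move=> it; rewrite -(leaf_lie_derivE nd slam leafL lX lamX fc cp Lp it).
  rewrite -(lieX c fc cp i it); apply: eq_bigr => j jn.
  have coefE (m : 'I_d) : (m < n)%N -> {in cfun c @` cdom c, fcoef c lambda m =1 fcoef c a m}.
    move=> mn x; rewrite inE => -[q cq <-]; rewrite /fcoef cfunKp // ext //.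
    exact: tangent_tvec (delta_slice mn).
  have cx : (cfun c @` cdom c) (cfun c p) by exists p.
  rewrite (coefE j jn) ?inE //; congr (_ * _ + _).
  exact: near_eq_partial (eq_on_near (@cimg_open _ _ _ c) (coefE i it) cx).
have XE : X p = b p *: u by rewrite /X tcoordK.
move: dX; rewrite XE => dX.
have {}dX (i : 'I_d) : (i < n)%N -> ext_deriv lambda p u (tvec c p (delta_mx 0 i)) = 0.
  move=> /dX; rewrite !ext_derivE -!scalemxAl mxE => /eqP.
  by rewrite mulf_eq0 gt_eqF //= => /eqP.
rewrite (ext_deriv_chart _ _ slam openT I ac cp) mxE big1 // => j _.
have [jn|nj] := ltnP j n; last by rewrite [_^T _ _]mxE ((tangentP _ fc cp).1 tw) // mulr0.
have := dX j jn; rewrite (ext_deriv_chart _ _ slam openT I ac cp) tvecK //.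
by rewrite trmx_delta -colE mxE => ->; rewrite mul0r.
Qed.

Hypothesis lambda_contact : contact_form setT lambda.
Hypothesis ker : forall p, form_ker lambda p = xi p.

(** As TG is the kernel of lambda in TF, invariance_ext_deriv0 provides the
hypothesis of isotropic_of_kernel_isotropic, and isotropic_reeb concludes. *)
Lemma reeb_tangent (v : vfield M) : is_reeb lambda v -> forall p, tangent F p (v p).
Proof.
move=> [_ v_reeb] p; have [dv lv] := v_reeb p.
have [llam _] := slam.
have [c fc cp] := fatlas_cover F p; have ac := fatlas_atlas fc.
have [vA lvc] := reeb_in_chart lambda_contact ac cp dv lv.
apply/(tangentP _ fc cp).
apply: (isotropic_reeb (contact_nondegenerate lambda_contact ac cp) vA lvc nd dn).
have [[t tt at0] _] := measure_kernel p.
have lt0 : lambda p t != 0 by rewrite ext //; exact/eqP.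
pose t1 := (lambda p t)^-1 *: t.
have tt1 : tangent F p t1 by exact: tangentZ.
apply: (@isotropic_of_kernel_isotropic _ _ _ (frow c lambda p)
  (dmat_anti c lambda p) n (tcoord c p t1)).
- exact: (tangentP _ fc cp).1.
- rewrite -(formE _ (llam p I) ac cp) /t1 -[_ *: t]addr0 llam //.
  by rewrite (linear_on0 (llam p I)) // addr0 mulVf.
- move=> x y Tx Ty lx.
  have tx := tangent_tvec fc cp Tx; have ty := tangent_tvec fc cp Ty.
  rewrite -[x](tvecK _ ac cp) -[y](tvecK _ ac cp).
  rewrite -(ext_deriv_chart _ _ slam openT I ac cp).
  apply: invariance_ext_deriv0 => //; rewrite tangentG; split => //.
  by rewrite -ker /form_ker /= (formE _ (llam p I) ac cp) tvecK.
Qed.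

End FromMeasure.
End Equivalence.

Theorem theorem3p6 (R : realType) (n : nat) (n_gt0 : (0 < n)%N)
    (M : smooth_manifold R (2 * n).-1) (xi : plane_field M)
    (xi_contact : contact_structure xi) :
  (exists F : foliation M n,
     co_legendrian F xi /\ has_invariant_measure F xi)
  <->
  (exists F : foliation M n,
     co_legendrian F xi /\
     exists lambda : one_form M,
       contact_form setT lambda /\
       (forall p, form_ker lambda p = xi p) /\
       exists v : vfield M,
         is_reeb lambda v /\ (forall p, tangent F p (v p))).
Proof.
have nd : (n <= (2 * n).-1)%N.
  by case: n n_gt0 {M xi xi_contact} => // m _; rewrite mul2n -addnn addnS leq_addr.
have dn : ((2 * n).-1 < n + n)%N.
  by case: n n_gt0 {M xi xi_contact nd} => // m _; rewrite mul2n -addnn.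
have od : odd (2 * n).-1.
  case: n n_gt0 {M xi xi_contact nd dn} => // m _.
  by rewrite mul2n doubleS /= odd_double.
split=> -[F [coF]].
  move=> [a sa inv]; have [_ [G tG]] := coF.
  have [a0 aker] : (forall p, exists2 v, tangent F p v & a p v <> 0%R) /\
     (forall p, tangent F p `&` form_ker a p = tangent F p `&` xi p)%classic.
    by split => p; have [] := measure_kernel inv p.
  have /choice [lambda lamP] := extension_exists xi_contact sa a0 aker.
  have slam : smooth_1form setT lambda.
    by apply: (smooth_of_extension xi_contact sa a0) => p; have [] := lamP p.
  have ker p : form_ker lambda p = xi p by have [] := lamP p.
  have ext p w : tangent F p w -> lambda p w = a p w.
    by have [_ _] := lamP p; apply.
  have lamC := contact_of_kernel xi_contact slam ker.
  have [v v_reeb] := reeb_exists lamC od.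
  exists F; split => //; exists lambda; split => //; split => //.
  exists v; split => //.
  exact: (reeb_tangent nd dn tG inv slam ext lamC ker v_reeb).
move=> [lambda [lamC [ker [v [v_reeb tv]]]]].
have [_ [G tG]] := coF.
exists F; split => //.
exact: (invariant_measure_of_reeb nd tG lamC ker v_reeb tv).
Qed.
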